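(* Let $\Gamma$ be a simplicial graph with countable vertex set $S$, let $(A_\Gamma,A_\Gamma^+)$ be the corresponding right-angled Artin group and let $\Omega$ be the Nica spectrum of the quasi-lattice order $(A_\Gamma,A_\Gamma^+)$. Then the abelianisation map $\phi:(A_\Gamma,A_\Gamma^+)\to(\mathbb Z,\mathbb N)^{|S|}$ is a controlled map, and the canonical partial action of $A_\Gamma$ is amenable when restricted to any closed invariant subset of $\Omega$.
   Context: $A_\Gamma=\langle S \mid ab=ba \text{ if } \{a,b\}\text{ is an edge of }\Gamma\rangle$ and $A_\Gamma^+$ is the submonoid generated by $S$. $(\mathbb Z,\mathbb N)^{|S|}$ is the direct sum of $|S|$ copies of $\mathbb Z$ with positive cone the elements with all coordinates in $\mathbb N=\{0,1,2,\dots\}$; the abelianisation map sends each $s\in S$ to the corresponding standard basis vector. A quasi-lattice ordered group $(G,P)$ is a group $G$ with a submonoid $P$ with $P\cap P^{-1}=\{e\}$ such that, for the left-invariant partial order $x\le y\iff x^{-1}y\in P$, every two elements of $G$ having a common upper bound have a least upper bound $x\vee y$; write $x\vee y=\infty$ if there is no common upper bound. Both $(A_\Gamma,A_\Gamma^+)$ and $(\mathbb Z,\mathbb N)^{|S|}$ are quasi-lattice ordered. Controlled map: an order-preserving homomorphism $\varphi:(G,P)\to(\mathcal G,\mathcal P)$ of quasi-lattice ordered groups such that (C1) the restriction $\varphi_P:P\to\mathcal P$ is finite-to-one, and (C2) for all $x,y\in P$ with $x\vee y\neq\infty$ one has $\varphi(x)\vee\varphi(y)=\varphi(x\vee y)$.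 Nica spectrum of $(G,P)$: $\Omega$ is the set of $\omega\subset G$ with $e\in\omega$ that are hereditary ($\omega P^{-1}\subset\omega$) and directed ($x\vee y\ne\infty$ and $x\vee y\in\omega$ for $x,y\in\omega$), with the (compact Hausdorff) topology from $\{0,1\}^G$. $G$ acts partially on $\Omega$ by $\theta_t:U_{t^{-1}}\to U_t$, $\omega\mapsto t\omega$, where $U_t=\{\omega:t\in\omega\}$. $X\subset\Omega$ is invariant if $\theta_t(X\cap U_{t^{-1}})\subset X$ for all $t$. Amenability: for closed invariant $X$ let $D_t=C_0(U_t\cap X)$ and $\alpha_t:D_{t^{-1}}\to D_t$, $f\mapsto f\circ\theta_{t^{-1}}$. $C(X)\rtimes G$ is the full partial crossed product: the universal C*-completion of finite sums $\sum f_t\delta_t$, $f_t\in D_t$, with $(f\delta_s)(g\delta_t)=\alpha_s(\alpha_{s^{-1}}(f)g)\delta_{st}$ and $(f\delta_t)^*=\alpha_{t^{-1}}(\bar f)\delta_{t^{-1}}$. The partial action on $X$ is amenable if the canonical map from the full to the reduced crossed product is an isomorphism; equivalently, the conditional expectation $\Phi:C(X)\rtimes G\to C(X)$ with $\Phi(f\delta_e)=f$ and $\Phi(f\delta_g)=0$ for $g\ne e$ is faithful on positive elements. *)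

(* Defs.v *)
From HB Require Import structures.
From mathcomp Require Import all_boot all_order all_algebra.
From mathcomp Require Import generic_quotient.
From mathcomp Require Import all_classical all_reals all_analysis.
From mathcomp Require Import complex.
From mathcomp Require freeg.

Set Implicit Arguments.
Unset Strict Implicit.
Unset Printing Implicit Defensive.

Import Order.TTheory GRing.Theory Num.Theory.
Import numFieldNormedType.Exports.

Local Open Scope classical_set_scope.
Local Open Scope ring_scope.

Section Presentations.
Local Open Scope quotient_scope.
Variables (S : choiceType) (rels : seq (S * bool) -> seq (S * bool) -> Prop).

(* A word is a list of letters (s, b): (s, true) stands for s and (s, false)
   for its inverse.  [pres_eq] is the congruence generated by [rels] and the
   free cancellations. *)
Inductive pres_eq : seq (S * bool) -> seq (S * bool) -> Prop :=
| pres_rel u v : rels u v -> pres_eq u v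
| pres_cancel s b : pres_eq [:: (s, b); (s, ~~ b)] [::]
| pres_cat u u' v v' :
    pres_eq u u' -> pres_eq v v' -> pres_eq (u ++ v) (u' ++ v')
| pres_refl u : pres_eq u u
| pres_sym u v : pres_eq u v -> pres_eq v u
| pres_trans u v w : pres_eq u v -> pres_eq v w -> pres_eq u w.

Definition pres_eqb (u v : seq (S * bool)) : bool := `[< pres_eq u v >].

Lemma pres_eqb_equiv : equiv_class_of pres_eqb.
Proof.
split=> [u|u v|v u w].
- by apply/asboolP; exact: pres_refl.
- by apply/asboolP/asboolP => ?; exact: pres_sym.
- by move=> /asboolP uv /asboolP vw; apply/asboolP; exact: pres_trans uv vw.
Qed.

Canonical pres_equiv := EquivRelPack pres_eqb_equiv.

Definition presented := {eq_quot pres_equiv}.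
HB.instance Definition _ := Choice.on presented.
HB.instance Definition _ := EqQuotient.on presented.

Lemma pres_pi u v : pres_eq u v <-> \pi_presented u = \pi_presented v.
Proof. by split=> [uv|/eqmodP /asboolP//]; apply/eqmodP/asboolP. Qed.

Lemma pres_repr u : pres_eq (repr (\pi_presented u)) u.
Proof. by apply/pres_pi; rewrite reprK. Qed.

Definition inv_word (u : seq (S * bool)) := rev [seq (p.1, ~~ p.2) | p <- u].

Definition pres_one : presented := \pi_presented [::].
Definition pres_mul (x y : presented) : presented :=
  \pi_presented (repr x ++ repr y).
Definition pres_inv (x : presented) : presented :=
  \pi_presented (inv_word (repr x)).

Lemma pres_mul_pi u v :
  pres_mul (\pi_presented u) (\pi_presented v) = \pi_presented (u ++ v).
Proof. by apply/pres_pi; apply: pres_cat; exact: pres_repr. Qed.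

Lemma pres_mulA : associative pres_mul.
Proof.
move=> x y z; elim/quotW: x => u; elim/quotW: y => v; elim/quotW: z => w.
rewrite (pres_mul_pi v w) (pres_mul_pi u v).
by rewrite (pres_mul_pi u (v ++ w)) (pres_mul_pi (u ++ v) w) catA.
Qed.

Lemma pres_mul1 : left_id pres_one pres_mul.
Proof. by move=> x; elim/quotW: x => u; rewrite pres_mul_pi. Qed.

Lemma pres_mulr1 : right_id pres_one pres_mul.
Proof. by move=> x; elim/quotW: x => u; rewrite pres_mul_pi cats0. Qed.

Lemma inv_wordK u : inv_word (inv_word u) = u.
Proof.
rewrite /inv_word map_rev revK -map_comp -[RHS]map_id.
by apply: eq_map => -[s b] /=; rewrite negbK.
Qed.

Lemma pres_eq_inv u : pres_eq (u ++ inv_word u) [::].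
Proof.
elim: u => [|[s b] u IH]; first exact: pres_refl.
have -> : ((s, b) :: u) ++ inv_word ((s, b) :: u) =
    [:: (s, b)] ++ ((u ++ inv_word u) ++ [:: (s, ~~ b)]).
  by rewrite /inv_word /= rev_cons -cats1 catA.
apply: pres_trans (pres_cancel s b).
rewrite -[X in pres_eq _ X]/([:: (s, b)] ++ ([::] ++ [:: (s, ~~ b)])).
apply: pres_cat; first exact: pres_refl.
by apply: pres_cat => //; exact: pres_refl.
Qed.

Lemma pres_mulV : left_inverse pres_one pres_inv pres_mul.
Proof.
move=> x; rewrite /pres_inv -{2}[x]reprK pres_mul_pi; apply/pres_pi.
by rewrite -{2}(inv_wordK (repr x)); exact: pres_eq_inv.
Qed.

Lemma pres_mulrV : right_inverse pres_one pres_inv pres_mul.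
Proof.
move=> x; rewrite /pres_inv -{1}[x]reprK pres_mul_pi; apply/pres_pi.
exact: pres_eq_inv.
Qed.

HB.instance Definition _ := isGroup.Build presented
  pres_mulA pres_mul1 pres_mulr1 pres_mulV pres_mulrV.

Definition pres_gen (s : S) : presented := \pi_presented [:: (s, true)].

End Presentations.

Section RightAngledArtin.
Variables (S : choiceType) (E : rel S).

Definition raag_rels (u v : seq (S * bool)) : Prop :=
  exists a b, [/\ E a b, u = [:: (a, true); (b, true)]
                       & v = [:: (b, true); (a, true)]].

Definition raag := presented raag_rels.
HB.instance Definition _ := Group.on raag.

Definition raag_gen (s : S) : raag := pres_gen raag_rels s.

End RightAngledArtin.

Definition submonoid (G : groupType) (P : set G) :=
  P 1%g /\ forall x y, P x -> P y -> P (x * y)%g.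

Definition raag_pos (S : choiceType) (E : rel S) : set (raag E) :=
  smallest (@submonoid (raag E)) (range (@raag_gen S E)).
Arguments raag_pos {S} E _.

Section QuasiLattice.
Variables (G : groupType) (P : set G).

Definition pos_le (x y : G) : Prop := P (x^-1 * y)%g.

(* [is_join x y z] reads "x \/ y is defined (not infinity) and equals z". *)
Definition is_join (x y z : G) : Prop :=
  [/\ pos_le x z, pos_le y z
    & forall u, pos_le x u -> pos_le y u -> pos_le z u].

Definition quasi_lattice : Prop :=
  [/\ submonoid P,
      P `&` [set x | P x^-1%g] = [set 1%g]
    & forall x y, (exists u, pos_le x u /\ pos_le y u) ->
                  exists z, is_join x y z].

End QuasiLattice.

Definition controlled (G H : groupType) (P : set G) (Q : set H)
    (phi : G -> H) : Prop :=
  [/\ quasi_lattice P, quasi_lattice Q,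
      forall x y, phi (x * y)%g = (phi x * phi y)%g
    & [/\ forall x y, pos_le P x y -> pos_le Q (phi x) (phi y),
          forall q, Q q -> finite_set (P `&` phi @^-1` [set q])
        & forall x y z, P x -> P y ->
            is_join P x y z -> is_join Q (phi x) (phi y) (phi z)]].

Section Abelianisation.
Variables (S : choiceType) (E : rel S).
Import freeg.

(* The direct sum of S copies of Z, written multiplicatively. *)
Definition zsum := Algebra.to_multiplicative {freeg S / int}.
HB.instance Definition _ := Group.on zsum.

Definition zsum_pos : set zsum :=
  [set x | forall s : S, 0 <= coeff s (x : {freeg S / int})].

Definition basis (s : S) : {freeg S / int} := << s >>.

Definition abel_word (u : seq (S * bool)) : {freeg S / int} :=
  \sum_(p <- u) (if p.2 then basis p.1 else - basis p.1).

Definition abelianisation (x : raag E) : zsum := abel_word (repr x).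

Lemma abel_word_eq u v : pres_eq (raag_rels E) u v -> abel_word u = abel_word v.
Proof.
rewrite /abel_word; elim=> {u v} //.
- move=> u v [a [b [_ -> ->]]].
  by rewrite !big_cons !big_nil /= !addr0 addrC.
- by move=> s [] /=; rewrite !big_cons !big_nil /= addr0 ?subrr ?addNr.
- by move=> u u' v v' _ uu' _ vv'; rewrite !big_cat /= uu' vv'.
- by move=> u v w _ -> _ ->.
Qed.

Lemma abelianisation_gen (s : S) :
  abelianisation (raag_gen E s) = basis s :> zsum.
Proof.
rewrite /abelianisation (abel_word_eq (pres_repr _ _)) /abel_word.
by rewrite big_cons big_nil addr0.
Qed.

Lemma abelianisationM (x y : raag E) :
  abelianisation (x * y)%g = (abelianisation x * abelianisation y)%g.
Proof.
rewrite /abelianisation (abel_word_eq (pres_repr _ _)).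
by rewrite /abel_word big_cat.
Qed.

End Abelianisation.
Arguments zsum_pos S _ : clear implicits.
Arguments abelianisation {S} E x.

Section NicaSpectrum.
Variables (G : groupType) (P : set G).

(* Subsets of G, with the topology of {0,1}^G. *)
Definition subsets : Type := {ptws G -> bool}.
HB.instance Definition _ := Topological.on subsets.

Definition nica_spectrum : set subsets :=
  [set w | [/\ w 1%g,
               forall x p, w x -> P p -> w (x * p^-1)%g
             & forall x y, w x -> w y -> exists2 z, is_join P x y z & w z]].

(* Left translation: [translate t w] is the set t w. *)
Definition translate (t : G) (w : subsets) : subsets :=
  fun g => w (t^-1 * g)%g.

(* U_t, the range of the partial homeomorphism theta_t. *)
Definition nica_dom (t : G) : set subsets :=
  nica_spectrum `&` [set w | w t].

Definition nica_closed (X : set subsets) : Prop :=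
  exists2 F : set subsets, closed F & X = nica_spectrum `&` F.

Definition nica_invariant (X : set subsets) : Prop :=
  forall t, translate t @` (X `&` nica_dom t^-1%g) `<=` X.

End NicaSpectrum.

(* The completion of a seminormed space (A, p), as the set of all classes of
   p-Cauchy sequences of elements of A modulo p-null sequences. *)
Section Completion.
Variables (R : realType) (V : zmodType) (A : set V).

Definition cauchy_seq (p : V -> R) (u : nat -> V) : Prop :=
  (forall n, A (u n)) /\
  forall e, 0 < e -> \forall m & n \near \oo, p (u m - u n) < e.

Definition seq_equiv (p : V -> R) (u v : nat -> V) : Prop :=
  (fun n => p (u n - v n)) @ \oo --> (0 : R).

Definition completion (p : V -> R) : set (set (nat -> V)) :=
  [set c | exists2 u, cauchy_seq p u
                    & c = cauchy_seq p `&` [set v | seq_equiv p u v]].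

(* For q <= p, the extension of the identity of A to a map from the completion
   for p to the completion for q. *)
Definition completion_map (p q : V -> R) (c : set (nat -> V)) :
    set (nat -> V) :=
  cauchy_seq q `&` [set v | exists2 u, c u & seq_equiv q u v].

End Completion.

Section CrossedProduct.
Variables (R : realType) (G : groupType) (P : set G) (X : set (subsets G)).

Local Notation T := (subsets G).
Local Notation C := R[i].
Local Notation "``| z |" := (Normc.normc z) (at level 0, z at level 99).

(* C_0(Y), each function being extended by 0 outside Y. *)
Definition C0 (Y : set T) : set (T -> C) :=
  [set f : T -> C | [/\ {within Y, continuous (f : T -> C^o)},
               forall e : R, 0 < e -> compact (Y `&` [set w | e <= ``|f w| ])
             & forall w, ~ Y w -> f w = 0]].

Definition cp_dom (t : G) : set T := nica_dom P t `&` X.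

(* The map alpha_t : D_(t^-1) -> D_t, f |-> f o theta_(t^-1). *)
Definition cp_act (t : G) (f : T -> C) : T -> C :=
  fun w => if w \in cp_dom t then f (translate t^-1%g w) else 0.

(* A finite sum of the f_t delta_t with f_t in D_t is encoded as the function
   t |-> f_t. *)
Definition cp_alg : set (G -> T -> C) :=
  [set a | finite_set [set t | a t != 0] /\ forall t, C0 (cp_dom t) (a t)].

Definition cp_mul (a b : G -> T -> C) : G -> T -> C := fun r w =>
  \sum_(s \in [set: G])
    cp_act s (fun v => cp_act s^-1%g (a s) v * b (s^-1 * r)%g v) w.

Definition cp_star (a : G -> T -> C) : G -> T -> C := fun t =>
  cp_act t (fun v => (a t^-1%g v)^*).

Definition cp_scale (c : C) (a : G -> T -> C) : G -> T -> C :=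
  fun t w => c * a t w.

Definition cstar_seminorm (p : (G -> T -> C) -> R) : Prop :=
  [/\ forall a, cp_alg a -> 0 <= p a,
      forall c a, cp_alg a -> p (cp_scale c a) = ``|c| * p a,
      forall a b, cp_alg a -> cp_alg b -> p (a + b) <= p a + p b,
      forall a b, cp_alg a -> cp_alg b -> p (cp_mul a b) <= p a * p b
    & forall a, cp_alg a ->
        p (cp_star a) = p a /\ p (cp_mul (cp_star a) a) = p a ^+ 2].

(* The norm of the universal C*-completion of [cp_alg]. *)
Definition full_norm (a : G -> T -> C) : R :=
  sup [set p a | p in cstar_seminorm].

Definition cp_expect (a : G -> T -> C) : T -> C := a 1%g.

Definition sup_norm (f : T -> C) : R := sup [set ``|f w| | w in X].

(* The norm of the Hilbert C(X)-module l^2 completing [cp_alg], whose inner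
   product is <x, y> = Phi(x^* y). *)
Definition l2_norm (x : G -> T -> C) : R :=
  Num.sqrt (sup_norm (cp_expect (cp_mul (cp_star x) x))).

(* The norm of a in the regular representation, where a acts on the Hilbert
   module l^2 by left multiplication. *)
Definition reduced_norm (a : G -> T -> C) : R :=
  sup [set l2_norm (cp_mul a x) | x in cp_alg `&` [set x | l2_norm x <= 1]].

Definition full_crossed_product := completion cp_alg full_norm.
Definition reduced_crossed_product := completion cp_alg reduced_norm.

(* The canonical map is a *-homomorphism of C*-algebras, so it is an
   isomorphism as soon as it is bijective. *)
Definition amenable : Prop :=
  set_bij full_crossed_product reduced_crossed_product
    (completion_map cp_alg full_norm reduced_norm).

End CrossedProduct.

(* Main.v *)
(* Combinatorics.  The right-angled Artin group acts on reduced "pilings" (one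
   stack for each generator), so a word without cancellation that equals a
   positive word is itself positive.  Applied to suitable reduced words this
   shows that a left-coprime fraction x^-1 y has the smallest denominator, hence
   joins exist, and that x^-1 (x \/ y) and y^-1 (x \/ y) have disjoint supports,
   hence abelianisation preserves joins.

   Amenability.  The reduced norm r is a C*-seminorm, so it suffices to prove
   p <= r for every C*-seminorm p on the algebra of finite sums.  One has
   p(a) <= |supp a| r(a); by the C*-identity p(z)^(2^k) = p(z^(2^k)) for
   self-adjoint z, this gives p(z) <= r(z) as soon as the supports of the powers
   of z grow subexponentially.  Join preservation shows that the powers of an
   element of degree 0 for the grading by the abelianisation have support in a
   fixed finite set, so p <= r on each homogeneous component x (apply this to
   x^* x).  In general z^(2^k) has polynomially many components because the
   grading group is abelian, and r does not increase when passing to one of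
   them; so the same argument applies once more. *)
Require Import Defs.
From mathcomp Require Import all_boot all_order all_algebra.
From mathcomp Require Import generic_quotient.
From mathcomp Require Import all_classical all_reals all_analysis.
From mathcomp Require Import complex finmap zify ring lra.
From mathcomp Require freeg.

Set Implicit Arguments.
Unset Strict Implicit.
Unset Printing Implicit Defensive.

Import Order.TTheory GRing.Theory Num.Theory.
Import numFieldNormedType.Exports.

Local Open Scope classical_set_scope.
Local Open Scope ring_scope.

(** * Words and pilings of a right-angled Artin group *)

(** Supports of powers of a general element can grow exponentially, as in a free group, so the
    support estimate alone settles only the kernel of the abelianisation; outside it one counts
    degrees instead of group elements. In the kernel, finiteness comes from the points of the
    spectrum: each nonzero coefficient at [t] over a point is witnessed by an [h] in that point with
    [h] and [t^-1 h] both positive. Directedness combines the witnesses of two factors by a join,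
    and join preservation keeps the degree of the result below the old bound.

    The estimate by the size of the support rests on p(f delta_t) <= sup |f|: the C*-identity moves
    it to C(X), where a real function with values in [0, 1] is the real part of a unitary. The
    reduced norm is handled through finite pieces of the matrices of [a] on the orbits of the points
    of [X], so that no Hilbert space has to be built. *)

Section Piling.
Variables (S : choiceType) (E : rel S).
Hypotheses (E_sym : symmetric E) (E_irr : irreflexive E).

Definition piling := S -> seq (option bool).
Implicit Types (f : piling) (p q : S * bool) (u v : seq (S * bool)).

Definition top f p := ohead (f p.1) == Some (Some p.2).

Definition flip p := (p.1, ~~ p.2).

(** Pilings in the sense of Crisp, Godelle and Wiest: a letter puts its sign on its own stack and a
    neutral bead [None] on the stack of every other generator that does not commute with it. The
    bead hides what lies below, so [top] detects the letters that commutations can bring to the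
    front. *)
Definition push p f : piling := fun t =>
  if E p.1 t then f t else (if p.1 == t then Some p.2 else None) :: f t.

Definition pop (s : S) f : piling := fun t =>
  if E s t then f t else behead (f t).

Definition pile p f := if top f (flip p) then pop p.1 f else push p f.

Definition piles u f := foldr pile f u.

Definition piling0 : piling := fun=> [::].

(* Only reduced pilings carry a group action: on an arbitrary piling a [pop]
   need not be undone by a [push]. *)
Inductive reduced_piling : piling -> Prop :=
| reduced_piling0 : reduced_piling piling0
| reduced_push p f :
    reduced_piling f -> ~~ top f (flip p) -> reduced_piling (push p f).

Lemma flipK : involutive flip.
Proof. by case=> s b; rewrite /flip /= negbK. Qed.

Lemma top_push_same p f q : p.1 = q.1 -> top (push p f) q = (p == q).
Proof.
case: p q => s b [t c] /= <-; rewrite /top /push /= E_irr eqxx /=.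
by rewrite xpair_eqE eqxx.
Qed.

Lemma top_push_adj p f q : E p.1 q.1 -> top (push p f) q = top f q.
Proof. by rewrite /top /push => ->. Qed.

Lemma top_push_nadj p f q : ~~ E p.1 q.1 -> p.1 != q.1 -> ~~ top (push p f) q.
Proof. by rewrite /top /push => /negbTE -> /negbTE ->. Qed.

Lemma pop_push p f : pop p.1 (push p f) = f.
Proof. by apply/funext => t; rewrite /pop /push; case: (E _ _). Qed.

Lemma push_pushC p q f : E p.1 q.1 -> push p (push q f) = push q (push p f).
Proof.
move=> Epq; apply/funext => t; rewrite /push.
case Ept: (E p.1 t); case Eqt: (E q.1 t) => //.
have -> : (p.1 == t) = false by apply/eqP => ?; subst t; rewrite E_sym Epq in Eqt.
by have -> : (q.1 == t) = false by apply/eqP => ?; subst t; rewrite Epq in Ept.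
Qed.

(** The last letter pushed either is [p] or commutes with [p] and can be exchanged with it; any
    other would leave a wrong sign or a [None] on top. Hence popping an exposed letter undoes a push
    and stays among reduced pilings. *)
Lemma reduced_top f p : reduced_piling f -> top f p ->
  exists2 g, reduced_piling g /\ ~~ top g (flip p) & f = push p g.
Proof.
elim=> [|q g rg IH ntop] //.
have [Eqp|NEqp] := boolP (E q.1 p.1).
  rewrite top_push_adj // => tp; have [h [rh nth] gE] := IH tp.
  have Epq : E p.1 q.1 by rewrite E_sym.
  exists (push q h); last by rewrite gE push_pushC.
  split; last by rewrite top_push_adj.
  by apply: reduced_push => //; rewrite gE top_push_adj in ntop.
have [qp|nqp] := eqVneq q.1 p.1; last first.
  by rewrite (negbTE (top_push_nadj _ NEqp nqp)).
by rewrite top_push_same // => /eqP <-; exists g.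
Qed.

Lemma reduced_pile p f : reduced_piling f -> reduced_piling (pile p f).
Proof.
move=> rf; rewrite /pile; case: ifPn => [tp|]; last exact: reduced_push.
by have [g [rg _] ->] := reduced_top rf tp; rewrite (pop_push (flip p)).
Qed.

Lemma reduced_piles u f : reduced_piling f -> reduced_piling (piles u f).
Proof. by move=> rf; elim: u => //= p u; exact: reduced_pile. Qed.

Lemma pileK p f : reduced_piling f -> pile (flip p) (pile p f) = f.
Proof.
move=> rf; rewrite {2}/pile; case: ifPn => [tp|ntp].
  have [g [rg ntg] fE] := reduced_top rf tp.
  by rewrite fE (pop_push (flip p)) /pile (negbTE ntg).
by rewrite /pile flipK top_push_same // eqxx (pop_push p).
Qed.

Lemma pile_push_adj p q f : reduced_piling f -> E p.1 q.1 ->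
  ~~ top f (flip q) -> pile p (push q f) = push q (pile p f).
Proof.
move=> rf Epq ntq; have Eqp : E q.1 p.1 by rewrite E_sym.
rewrite /pile top_push_adj //; case: ifPn => [tp|ntp]; last exact: push_pushC.
have [g [rg ntg] fE] := reduced_top rf tp.
by rewrite fE push_pushC // !(pop_push (flip p)).
Qed.

(** For commuting letters, whether one of them cancels does not depend on the other; this makes the
    action respect the defining relations. *)
Lemma pileC p q f : reduced_piling f -> E p.1 q.1 ->
  pile p (pile q f) = pile q (pile p f).
Proof.
move=> rf Epq; have Eqp : E q.1 p.1 by rewrite E_sym.
have [tq|ntq] := boolP (top f (flip q)); last first.
  rewrite {2}/pile (negbTE ntq) pile_push_adj //.
  rewrite {2}/pile; case: ifPn => // tpq; move: ntq tpq.
  rewrite /pile; case: ifPn => [tp|ntp]; last by rewrite top_push_adj // => /negbTE->.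
  have [g [rg ntg] fE] := reduced_top rf tp.
  by rewrite fE (pop_push (flip p)) top_push_adj // => /negbTE ->.
have [g [rg ntg] fE] := reduced_top rf tq.
have q_g : pile q f = g by rewrite /pile tq fE (pop_push (flip q)).
rewrite q_g fE pile_push_adj //.
(* When [q] cancels, [f] is [g] with [flip q] pushed. Once [flip q] is known to be pushed, not
   cancelled, on [pile p g], [pileK] removes it again. *)
suff <- : pile (flip q) (pile p g) = push (flip q) (pile p g).
  by have := pileK (flip q) (reduced_pile p rg); rewrite flipK => ->.
rewrite {1}/pile; case: ifPn => // tpq; move: ntg tpq.
rewrite /pile; case: ifPn => [tp|ntp]; last by rewrite top_push_adj // => /negbTE->.
have [h [rh nth] gE] := reduced_top rg tp.
by rewrite gE (pop_push (flip p)) top_push_adj // => /negbTE ->.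
Qed.

Lemma piles_cat u v f : piles (u ++ v) f = piles u (piles v f).
Proof. exact: foldr_cat. Qed.

Lemma piles_pres_eq u v : pres_eq (raag_rels E) u v ->
  forall f, reduced_piling f -> piles u f = piles v f.
Proof.
elim=> {u v} //.
- by move=> u v [a [b [Eab -> ->]]] f rf /=; exact: pileC.
- by move=> s [] f rf; [exact: (pileK (s, false))|exact: (pileK (s, true))].
- move=> u u' v v' _ IHu _ IHv f rf; rewrite !piles_cat IHv // IHu //.
  exact: reduced_piles.
- by move=> u v _ IH f rf; rewrite IH.
- by move=> u v w _ IHu _ IHv f rf; rewrite IHu // IHv.
Qed.

(* The stack over [s] when no letter of the word gets cancelled. *)
Definition column u (s : S) :=
  [seq if p.1 == s then Some p.2 else None | p <- u & ~~ E p.1 s].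

Fixpoint reduced_word u :=
  if u is p :: v then ~~ top (column v) (flip p) && reduced_word v else true.

Lemma piles_reduced u : reduced_word u -> piles u piling0 = column u.
Proof.
elim: u => [|p u IH] //= /andP[ntp /IH ->].
rewrite /pile (negbTE ntp); apply/funext => t.
by rewrite /push /column /=; case: (E _ _).
Qed.

Lemma column_top u p : top (column u) p ->
  exists u1 u2, u = u1 ++ p :: u2 /\ all (fun q => E q.1 p.1) u1.
Proof.
elim: u => [|q u IH] //; rewrite /top /column /=.
case Eqp: (E q.1 p.1) => /=.
  by move=> /IH [u1 [u2 [-> u1E]]]; exists (q :: u1), u2; rewrite /= Eqp.
case: (q.1 =P p.1) => //= qp /eqP qp2; exists [::], u; split=> //=.
by case: q p qp qp2 {Eqp IH} => [a b] [c d] /= -> [->].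
Qed.

Lemma column_neg u s : (s, false) \in u -> Some false \in column u s.
Proof.
move=> su; apply/mapP; exists (s, false) => /=; last by rewrite eqxx.
by rewrite mem_filter /= E_irr.
Qed.

Lemma reduced_pos (u : seq S) : reduced_word [seq (s, true) | s <- u].
Proof.
elim: u => //= s u ->; rewrite andbT; apply/negP => /column_top[u1 [u2 [uE _]]].
have : (s, false) \in [seq (t, true) | t <- u].
  by rewrite uE mem_cat inE eqxx orbT.
by case/mapP.
Qed.

(** The piling depends only on the group element, and a reduced word leaves all its signs in the
    stacks: a negative letter of [u] would show up in the piling of a positive word. *)
Lemma reduced_eq_pos u (w : seq S) : reduced_word u ->
  pres_eq (raag_rels E) u [seq (s, true) | s <- w] ->
  forall p, p \in u -> p.2.
Proof.
move=> ru uw [s []] // su; have /= := column_neg su.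
rewrite -piles_reduced // (piles_pres_eq uw); last exact: reduced_piling0.
rewrite piles_reduced ?reduced_pos // => /mapP[[t b]].
by rewrite mem_filter /= => /andP[_ /mapP[? _ [-> ->]]]; case: ifP.
Qed.

End Piling.

(** * The quasi-lattice order of a right-angled Artin group *)

Lemma map_cat_consP (T T' : Type) (f : T -> T') (l : seq T) l1 y l2 :
  [seq f i | i <- l] = l1 ++ y :: l2 ->
  exists l1' x l2', [/\ l = l1' ++ x :: l2', l1 = map f l1', y = f x
                       & l2 = map f l2'].
Proof.
elim: l l1 => [|x l IH] [|z l1] //=.
  by move=> [<- <-]; exists [::], x, l.
by move=> [<- /IH[l1' [x' [l2' [-> -> -> ->]]]]]; exists (x :: l1'), x', l2'.
Qed.

Section RaagOrder.
Variables (S : choiceType) (E : rel S).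
Hypotheses (E_sym : symmetric E) (E_irr : irreflexive E).
Local Notation G := (raag E).
Local Notation P := (raag_pos E).
Local Open Scope group_scope.
Implicit Types (x y z : G) (s : S) (u v : seq (S * bool)) (a b c : seq S).

Definition wordg u : G := \pi_(presented (raag_rels E))%qT u.
Definition posw a := [seq (s, true) | s <- a].
Definition negw a := [seq (s, false) | s <- a].
Definition posg a : G := wordg (posw a).
Local Notation gen := (@raag_gen S E).
Local Notation col := (column E).

Lemma wordg_cat u v : wordg (u ++ v) = wordg u * wordg v.
Proof. by rewrite [RHS]pres_mul_pi. Qed.

Lemma wordg_eq u v : wordg u = wordg v <-> pres_eq (raag_rels E) u v.
Proof. by split=> /pres_pi. Qed.

Lemma wordg_nil : wordg [::] = 1.
Proof. by []. Qed.

Lemma wordg_true s : wordg [:: (s, true)] = gen s.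
Proof. by []. Qed.

Lemma wordg_false s : wordg [:: (s, false)] = (gen s)^-1.
Proof.
apply: (mulgI (gen s)); rewrite mulgV -wordg_true -wordg_cat -wordg_nil.
by apply/wordg_eq; exact: (pres_cancel _ s true).
Qed.

Lemma posg_cat a b : posg (a ++ b) = posg a * posg b.
Proof. by rewrite /posg /posw map_cat wordg_cat. Qed.

Lemma posg_cons s a : posg (s :: a) = gen s * posg a.
Proof. by rewrite -cat1s posg_cat. Qed.

Lemma wordg_negw a : wordg (negw (rev a)) = (posg a)^-1.
Proof.
elim: a => [|s a IH]; first by rewrite wordg_nil invg1.
rewrite rev_cons /negw -cats1 map_cat wordg_cat [wordg (map _ _)]IH.
by rewrite wordg_false posg_cons invgM.
Qed.

Lemma gen_commute s t : E s t -> commute (gen s) (gen t).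
Proof.
move=> Est; rewrite /commute -!wordg_true -!wordg_cat; apply/wordg_eq.
by apply: pres_rel; exists s, t.
Qed.

Lemma posg_commute s a : all (E^~ s) a -> commute (posg a) (gen s).
Proof.
elim: a => [|t a IH] /=; first by move=> _; exact/commute_sym/commute1.
move=> /andP[/gen_commute ts /IH sa]; rewrite posg_cons; apply/commute_sym.
by apply: commuteM; exact: commute_sym.
Qed.

Lemma posgP x : P x <-> exists a, x = posg a.
Proof.
split=> [|[a ->]].
- move=> Px; apply: (Px [set z | exists a, z = posg a]); split; last by move=> _ [s _ <-]; exists [:: s].
  by split=> [|_ _ [a ->] [b ->]]; [exists [::]|exists (a ++ b); rewrite posg_cat].
- elim: a => [|s a IH] Q QP; have [[Q1 QM] genQ] := QP; first exact: Q1.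
  by rewrite posg_cons; apply: QM; [apply: genQ; exists s|exact: (IH Q QP)].
Qed.

Lemma posg_pos a : P (posg a). Proof. by apply/posgP; exists a. Qed.

Lemma pos1 : P 1. Proof. exact: (posg_pos [::]). Qed.

Lemma posM x y : P x -> P y -> P (x * y).
Proof.
by move=> /posgP[a ->] /posgP[b ->]; rewrite -posg_cat; exact: posg_pos.
Qed.

Lemma pos_gen s : P (gen s). Proof. exact: (posg_pos [:: s]). Qed.

Lemma posg_pull_left s a b : all (E^~ s) a ->
  posg (a ++ s :: b) = gen s * posg (a ++ b).
Proof.
move=> /posg_commute sa.
by rewrite !posg_cat posg_cons !mulgA sa.
Qed.

Lemma posg_pull_right s a b : all (E^~ s) b ->
  posg (a ++ s :: b) = posg (a ++ b) * gen s.
Proof.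
move=> /posg_commute sb.
by rewrite !posg_cat posg_cons -!mulgA sb.
Qed.

Lemma col_cat u v s : col (u ++ v) s = col u s ++ col v s.
Proof. by rewrite /column filter_cat map_cat. Qed.

Lemma top_col_cat u v p : top (col (u ++ v)) p =
  if col u p.1 is [::] then top (col v) p else top (col u) p.
Proof. by rewrite /top col_cat; case: (col u p.1). Qed.

Lemma col_nil u s : col u s = [::] -> all (fun q => E q.1 s) u.
Proof.
rewrite /column; elim: u => //= p u IH.
by case: (E _ _) => //= /IH.
Qed.

Lemma top_col_mem u p : top (col u) p -> p \in u.
Proof.
by case/column_top => u1 [u2 [-> _]]; rewrite mem_cat inE eqxx orbT.
Qed.

Lemma mem_posw a s (k : bool) : (s, k) \in posw a -> k /\ s \in a.
Proof. by case/mapP => t ta [-> ->]. Qed.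

Lemma mem_negw a s (k : bool) : (s, k) \in negw a -> ~~ k /\ s \in a.
Proof. by case/mapP => t ta [-> ->]. Qed.

Lemma col_posw_rev a s : col (posw (rev a)) s = rev (col (posw a) s).
Proof. by rewrite /column /posw map_rev filter_rev map_rev. Qed.

Lemma reduced_word_cat u v : reduced_word E v ->
  (forall u1 p u2, u = u1 ++ p :: u2 -> ~~ top (col (u2 ++ v)) (flip p)) ->
  reduced_word E (u ++ v).
Proof.
move=> rv; elim: u => //= p u IH H.
rewrite (H [::] p u) //=; apply: IH => u1 q u2 uE.
by apply: (H (p :: u1) q u2); rewrite uE.
Qed.

Lemma top_posw a s : top (col (posw a)) (s, true) -> P ((gen s)^-1 * posg a).
Proof.
move=> /column_top[u1 [u2 [aE sa1]]]; move: aE => /(@map_cat_consP _ _ (fun s => (s, true)))[a1 [t [a2 [-> u1E [st] _]]]]; subst u1 t.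
rewrite posg_pull_left; first by rewrite mulKg; exact: posg_pos.
by move: sa1; rewrite all_map.
Qed.

Lemma top_posw_rev a s : top (col (posw (rev a))) (s, true) ->
  P (posg a * (gen s)^-1).
Proof.
move=> /column_top[u1 [u2 [aE sa1]]]; move: aE => /(@map_cat_consP _ _ (fun s => (s, true)))[a1 [t [a2 [aE' u1E [st] _]]]]; subst u1 t.
have -> : a = rev a2 ++ s :: rev a1.
  by rewrite -[a]revK aE' rev_cat rev_cons cat_rcons.
rewrite posg_pull_right; first by rewrite mulgK; exact: posg_pos.
by move: sa1; rewrite all_map all_rev.
Qed.

(** Otherwise appending the inverse of [s] to [a] gives a reduced word with a negative letter for a
    positive element, against [reduced_eq_pos]. Divisibility on the right by a generator can thus be
    read off any positive word. *)
Lemma posg_divr a s : P (posg a * (gen s)^-1) ->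
  top (col (posw (rev a))) (s, true).
Proof.
move=> /posgP[b]; rewrite /posg -wordg_false -wordg_cat => /wordg_eq abE.
apply/negPn/negP => ntop.
suff red : reduced_word E (posw a ++ [:: (s, false)]).
  by have := reduced_eq_pos E_sym E_irr red abE (p := (s, false)); rewrite mem_cat inE eqxx orbT => /(_ isT).
apply: reduced_word_cat => // u1 p u2 /(@map_cat_consP _ _ (fun s => (s, true)))[a1 [t [a2 [aE _ -> ->]]]].
rewrite /flip /= top_col_cat /=; apply/negP.
case colE: (col (posw a2) t) => [|k l]; last by move=> /top_col_mem/mem_posw[].
move=> /top_col_mem; rewrite inE => /eqP[ts]; subst t.
move: ntop; rewrite aE rev_cat rev_cons cat_rcons /posw map_cat.
rewrite top_col_cat /= [col _ s]col_posw_rev colE /=.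
by rewrite /top /column /= E_irr /= eqxx.
Qed.

(** Either [b] contributes to the stack over [s] and decides what is final, or it contributes
    nothing, which means that all its letters commute with [s]. *)
Lemma posg_div_cat a b s : P (posg a * posg b * (gen s)^-1) ->
  P (posg b * (gen s)^-1) \/ P (posg a * (gen s)^-1) /\ all (E^~ s) b.
Proof.
rewrite -posg_cat => /posg_divr; rewrite rev_cat /posw map_cat top_col_cat /=.
case colE: (col _ s) => [|k l] st; [right|left]; last exact: top_posw_rev.
split; first exact: top_posw_rev.
by have := col_nil colE; rewrite all_map all_rev.
Qed.

Lemma posg_final_mem a s : P (posg a * (gen s)^-1) -> s \in a.
Proof. by move=> /posg_divr/top_col_mem/mem_posw[_]; rewrite mem_rev. Qed.

(* Cancelling the last letter [c] of [a]: either it is also final in [b], or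
   [b] commutes with it and the pair [(a', b)] is a smaller instance. *)
Lemma common_final s a x y b : P x -> P y -> x * posg a = y * posg b ->
  s \in a -> s \in b ->
  exists t, P (posg a * (gen t)^-1) /\ P (posg b * (gen t)^-1).
Proof.
move=> Px; elim/last_ind: a y => [|a c IH] // y /posgP[d ->] xayb sa sb.
have aE : posg (rcons a c) = posg a * gen c by rewrite -cats1 posg_cat.
have xaE : x * posg a = posg d * posg b * (gen c)^-1.
  by rewrite -xayb aE mulgA mulgK.
have /posg_div_cat[bc|[dc bC]] : P (posg d * posg b * (gen c)^-1).
- by rewrite -xaE; apply: posM => //; exact: posg_pos.
- by exists c; split=> //; rewrite aE mulgK; exact: posg_pos.
have bc := posg_commute bC.
(* [c] commutes with every letter of [b], among them [s], so [s] differs from [c] by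
   irreflexivity. *)
have sa' : s \in a.
  move: sa; rewrite mem_rcons inE => /orP[/eqP sc|//].
  by have := allP bC _ sb; rewrite sc E_irr.
have [|e [ae be]] := IH _ dc _ sa' sb.
  rewrite xaE -!mulgA; congr (_ * _); apply: commuteV => //.
exists e; split=> //.
(* [e] occurs in [b], hence commutes with [c] and stays final when [c] is put back. *)
have Eec := allP bC _ (posg_final_mem be).
rewrite aE -mulgA (commuteV (commute_sym (gen_commute Eec))) mulgA.
by apply: posM => //; exact: pos_gen.
Qed.

End RaagOrder.

(** * Joins in the right-angled Artin group *)

Section RaagLattice.
Variables (S : choiceType) (E : rel S).
Hypotheses (E_sym : symmetric E) (E_irr : irreflexive E).
Local Notation G := (raag E).
Local Notation P := (raag_pos E).
Local Notation gen := (@raag_gen S E).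
Local Notation col := (column E).
Local Notation posg := (posg E).
Import freeg.

Definition degree (x : G) : int := deg (abelianisation E x : {freeg S / int}).

Lemma degreeM (x y : G) : degree (x * y)%g = degree x + degree y.
Proof. by rewrite /degree abelianisationM degD. Qed.

Lemma degree_gen s : degree (gen s) = 1.
Proof. by rewrite /degree abelianisation_gen degU. Qed.

Lemma degree1 : degree 1%g = 0.
Proof. by have := degreeM 1%g 1%g; rewrite mulg1; lia. Qed.

Lemma degree_posg a : degree (posg a) = size a.
Proof.
elim: a => [|s a IH]; first exact: degree1.
by rewrite posg_cons degreeM degree_gen IH.
Qed.

Lemma degree_ge0 x : P x -> 0 <= degree x.
Proof. by move=> /posgP[a ->]; rewrite degree_posg. Qed.

Lemma degree_eq0 x : P x -> degree x = 0 -> x = 1%g.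
Proof. by move=> /posgP[[|s a] ->] //; rewrite degree_posg. Qed.

Lemma coeff_posg s a :
  coeff s (abelianisation E (posg a) : {freeg S / int}) = count_mem s a.
Proof.
elim: a => [|t a IH].
  have -> : posg [::] = 1%g by [].
  suff -> : abelianisation E 1%g = 0 :> {freeg S / int} by rewrite coeff0.
  have := abelianisationM (1%g : G) 1%g; rewrite mulg1 => h.
  by apply: (@addrI _ (abelianisation E 1%g : {freeg S / int})); rewrite addr0 [RHS]h.
rewrite posg_cons abelianisationM [LHS]coeffD IH abelianisation_gen coeffU /=.
by rewrite mul1r natz.
Qed.

Local Open Scope group_scope.
Implicit Types (x y z p q : G) (s : S) (a b c : seq S).

(** Common final generators are split off one at a time, and [degree x] drops by one each time.
    [extract_left] is the mirror image. *)
Lemma extract_right x y : P x -> P y -> exists x' y' z,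
  [/\ P x', P y', P z, x = x' * z & y = y' * z /\
    forall s, ~ (P (x' * (gen s)^-1) /\ P (y' * (gen s)^-1))].
Proof.
have [n] := ubnP `|degree x|%N; elim: n x y => // n IH x y ltn Px Py.
have [[s [xs ys]]|nex] := pselect (exists s, P (x * (gen s)^-1) /\
    P (y * (gen s)^-1)); last first.
  exists x, y, 1; rewrite !mulg1; split=> //; first exact: pos1.
  by split=> // s xys; apply: nex; exists s.
have [|x' [y' [z [Px' Py' Pz xE [yE cop]]]]] := IH _ _ _ xs ys.
  have := degreeM (x * (gen s)^-1) (gen s); rewrite mulgVK degree_gen.
  by have := degree_ge0 xs; lia.
exists x', y', (z * gen s); split=> //; first by apply: posM => //; exact: pos_gen.
  by rewrite mulgA -xE mulgVK.
by split=> //; rewrite mulgA -yE mulgVK.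
Qed.

Lemma extract_left x y : P x -> P y -> exists x' y' z,
  [/\ P x', P y', P z, x = z * x' & y = z * y' /\
    forall s, ~ (P ((gen s)^-1 * x') /\ P ((gen s)^-1 * y'))].
Proof.
have [n] := ubnP `|degree x|%N; elim: n x y => // n IH x y ltn Px Py.
have [[s [xs ys]]|nex] := pselect (exists s, P ((gen s)^-1 * x) /\
    P ((gen s)^-1 * y)); last first.
  exists x, y, 1; rewrite !mul1g; split=> //; first exact: pos1.
  by split=> // s xys; apply: nex; exists s.
have [|x' [y' [z [Px' Py' Pz xE [yE cop]]]]] := IH _ _ _ xs ys.
  have := degreeM (gen s) ((gen s)^-1 * x); rewrite mulVKg degree_gen.
  by have := degree_ge0 xs; lia.
exists x', y', (gen s * z); split=> //; first by apply: posM => //; exact: pos_gen.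
  by rewrite -mulgA -xE mulVKg.
by split=> //; rewrite -mulgA -yE mulVKg.
Qed.

(* If [x], [y] have no common initial letter, then [x^-1 y] is the fraction
   with the smallest denominator.  Removing from [p] and [x] their greatest
   common right factor turns [p x^-1 y] into a reduced word, and such a word is
   positive only if nothing is left of [x]. *)
Lemma coprime_fraction p x y : P p -> P x -> P y ->
  (forall s, ~ (P ((gen s)^-1 * x) /\ P ((gen s)^-1 * y))) ->
  P (p * x^-1 * y) -> P (p * x^-1).
Proof.
move=> Pp Px Py xy.
have [p' [x' [z [/posgP[a p'E] /posgP[c x'E] Pz pE [xE px]]]]] := extract_right Pp Px.
have -> : p * x^-1 = p' * x'^-1 by rewrite pE xE invgM mulgA mulgK.
move: Py => /posgP[d yE] /posgP[e]; rewrite x'E p'E yE.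
rewrite -wordg_negw /posg -!wordg_cat -catA => /wordg_eq wE.
suff red : reduced_word E (posw a ++ negw (rev c) ++ posw d).
  have c0 : c = [::].
    case: c {x'E px} wE red => // s c wE red.
    have /negP[] // : ~~ (s, false).2 by [].
    apply: (reduced_eq_pos E_sym E_irr red wE); rewrite !mem_cat.
    apply/orP; right; apply/orP; left; apply/mapP; exists s => //.
    by rewrite mem_rev inE eqxx.
  by rewrite c0 /= cats0; exact: posg_pos.
apply: reduced_word_cat.
  (* Junction of [negw (rev c)] and [posw d]: a cancellation there would exhibit a common initial
     generator of [x] and [y]. *)
  apply: reduced_word_cat; first exact: reduced_pos.
  move=> u1 q u2 /(@map_cat_consP _ _ (fun s => (s, false)))[e1 [s [e2 [cE _ -> ->]]]].
  apply/negP; rewrite /flip /= top_col_cat /=.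
  case colE: (column _ _ _) => [|k l]; last first.
    by move=> /top_col_mem/(@mem_negw _ _ _ _)[].
  move=> /top_posw sd; apply: (xy s); split; last by rewrite yE.
  have e2s : all (E^~ s) e2 by have := col_nil colE; rewrite all_map.
  rewrite xE x'E -[c]revK cE rev_cat rev_cons cat_rcons posg_pull_left.
    by rewrite !mulgA mulVg mul1g; apply: posM => //; exact: posg_pos.
  by rewrite all_rev.
(* A letter of [a] can only cancel against [negw (rev c)], since [d] is positive; its generator
   would be final in both [p'] and [x']. *)
move=> u1 q u2 /(@map_cat_consP _ _ (fun s => (s, true)))[a1 [s [a2 [aE _ -> ->]]]].
apply/negP; rewrite /flip /= top_col_cat /=.
case colE: (column _ _ _) => [|k l]; last first.
  by move=> /top_col_mem/(@mem_posw _ _ _ _)[].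
have a2s : all (E^~ s) a2 by have := col_nil colE; rewrite all_map.
rewrite top_col_cat /=.
case colE': (column _ _ _) => [|k l]; first by move=> /top_col_mem/(@mem_posw _ _ _ _)[].
move=> /column_top[v1 [v2 [wcE sv1]]]; move: wcE.
move=> /(@map_cat_consP _ _ (fun s => (s, false)))[e1 [t [e2 [cE v1E [st] _]]]].
subst t v1; apply: (px s); split.
  by rewrite p'E aE posg_pull_right // mulgK; exact: posg_pos.
rewrite x'E -[c]revK cE rev_cat rev_cons cat_rcons posg_pull_right.
  by rewrite mulgK; exact: posg_pos.
by move: sv1; rewrite all_map all_rev.
Qed.

Lemma raag_pos_inv : P `&` [set x | P x^-1] = [set 1].
Proof.
apply/seteqP; split=> x /=; last by move=> ->; rewrite invg1; split; exact: pos1.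
move=> [Px Pix]; apply: degree_eq0 => //.
have := degreeM x x^-1; rewrite mulgV degree1.
by have := degree_ge0 Px; have := degree_ge0 Pix; lia.
Qed.

(** An upper bound [u] closest to [x] is least. If an upper bound [v] is not above [u], write
    [x^-1 u = m a] and [x^-1 v = m b] with no common initial generator of [a] and [b]. Then
    [y^-1 u a^-1 b = y^-1 v] is positive, and [coprime_fraction] makes [u a^-1] a closer upper
    bound. *)
Lemma raag_join x y : (exists u, pos_le P x u /\ pos_le P y u) ->
  exists z, is_join P x y z.
Proof.
move=> [u []]; have [n] := ubnP `|degree (x^-1 * u)%g|%N.
elim: n u => // n IH u ltn xu yu.
have [umin|] := pselect (forall v, pos_le P x v -> pos_le P y v -> pos_le P u v).
  by exists u.
move=> /existsNP[v /not_implyP[xv /not_implyP[yv uv]]].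
have [a [b [m [Pa Pb Pm aE [bE ab]]]]] := extract_left xu xv.
have uva : u^-1 * v = a^-1 * b.
  have uE : u = x * m * a by rewrite -mulgA -aE mulVKg.
  have vE : v = x * m * b by rewrite -mulgA -bE mulVKg.
  by rewrite uE vE invgM -mulgA mulKg.
have yua : P (y^-1 * u * a^-1).
  apply: (coprime_fraction (y := b)) => //.
  by rewrite -[_ * _ * b]mulgA -uva -mulgA mulVKg.
apply: (IH (u * a^-1)); last 2 first.
- by rewrite /pos_le mulgA aE mulgK.
- by rewrite /pos_le mulgA.
rewrite mulgA aE mulgK; move: ltn; rewrite aE degreeM.
have a1 : degree a <> 0.
  by move=> /(degree_eq0 Pa) a1; apply: uv; rewrite /pos_le uva a1 invg1 mul1g.
by have := degree_ge0 Pa; have := degree_ge0 Pm; lia.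
Qed.

Lemma raag_quasi_lattice : quasi_lattice P.
Proof.
split; [split; [exact: pos1|exact: posM] | exact: raag_pos_inv | exact: raag_join].
Qed.

(** A generator [s] occurring in both quotients yields by [common_final] a generator [t], possibly
    another one, that is final in both; then [z t^-1] would be a common upper bound strictly below
    the join. *)
Lemma join_disjoint x y z : P x -> P y -> is_join P x y z ->
  forall s, coeff s (abelianisation E (x^-1 * z) : {freeg S / int}) = 0%R \/
    coeff s (abelianisation E (y^-1 * z) : {freeg S / int}) = 0%R.
Proof.
move=> Px Py [/posgP[a xz] /posgP[b yz] zmin] s; rewrite xz yz !coeff_posg.
have [sa|/count_memPn ->] := boolP (s \in a); last by left.
have [sb|/count_memPn ->] := boolP (s \in b); last by right.
have xayb : x * posg a = y * posg b by rewrite -xz -yz !mulVKg.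
have [t [at' bt]] := common_final E_sym E_irr Px Py xayb sa sb.
have : pos_le P z (z * (gen t)^-1).
  by apply: zmin; rewrite /pos_le mulgA ?xz ?yz.
rewrite /pos_le mulKg => Pt.
have t1 : (P `&` [set x | P x^-1]) (gen t) by split=> //; exact: pos_gen.
by rewrite raag_pos_inv in t1; have := degree_gen t; rewrite t1 degree1.
Qed.

End RaagLattice.

(** * The abelianisation is controlled *)

Lemma finite_bounded_words (T : choiceType) (d : seq T) n :
  finite_set [set a : seq T | (size a <= n)%N /\ {subset a <= d}].
Proof.
elim: n => [|n IH].
  apply: (@sub_finite_set _ _ [set [::]]) => //.
  by move=> [|t a] [].
apply: (@sub_finite_set _ _ ([set [::]] `|`
  (fun p => p.1 :: p.2) @` ([set t | t \in d] `*`
     [set a : seq T | (size a <= n)%N /\ {subset a <= d}]))).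
  move=> [|t a] /= [sa da]; first by left.
  right; exists (t, a) => //; split=> /=; first by apply: da; rewrite inE eqxx.
  by split=> // u ua; apply: da; rewrite inE ua orbT.
rewrite finite_setU; split=> //; apply: finite_image; apply: finite_setX => //.
Qed.

Section AbelianLattice.
Variable S : choiceType.
Local Notation Q := (zsum_pos S).
Import freeg.
Local Notation coef s x := (coeff s (x : {freeg S / int})).

Lemma zsum_eqP (x y : zsum S) : (forall s, coef s x = coef s y) -> x = y.
Proof. by move=> xy; apply/eqP/freeg_eqP. Qed.

Lemma coef_one s : coef s (1%g : zsum S) = 0.
Proof. exact: coeff0. Qed.

Lemma coefM s (x y : zsum S) : coef s (x * y)%g = coef s x + coef s y.
Proof. exact: coeffD. Qed.

Lemma coefV s (x : zsum S) : coef s (x^-1)%g = - coef s x.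
Proof. exact: coeffN. Qed.

Lemma zsum_commute (x y : zsum S) : commute x y.
Proof. exact: (@addrC {freeg S / int}). Qed.

Lemma zsum_leP (x y : zsum S) : pos_le Q x y <-> forall s, coef s x <= coef s y.
Proof.
by rewrite /pos_le; split=> xy s; have := xy s; rewrite coefM coefV; lia.
Qed.

Lemma zsum_quasi_lattice : quasi_lattice Q.
Proof.
split.
- split=> [s|x y Qx Qy s]; first by rewrite coef_one.
  by rewrite coefM addr_ge0.
- apply/seteqP; split=> x /= => [[Qx Qix]|->]; last first.
    by rewrite invg1; split=> s; rewrite coef_one.
  apply: zsum_eqP => s; have := Qx s; have := Qix s.
  by rewrite coefV coef_one; lia.
- move=> x y _.
  (* The coordinatewise maximum, written as [x] plus the positive part of [y - x]. *)
  pose z : zsum S := (x : {freeg S / int}) + fgpos ((y : {freeg S / int}) - x).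
  have zE s : coef s z = Num.max (coef s x) (coef s y).
    by rewrite /z coeffD coeff_fgposE coeffB addr_maxr addr0 addrC subrK.
  exists z; split; first by apply/zsum_leP => s; rewrite zE le_max lexx ?orbT.
    by apply/zsum_leP => s; rewrite zE le_max lexx ?orbT.
  move=> u /zsum_leP xu /zsum_leP yu; apply/zsum_leP => s.
  by rewrite zE ge_max xu yu.
Qed.

Lemma deg_le (x y : {freeg S / int}) :
  (forall s, coeff s x <= coeff s y) -> deg x <= deg y.
Proof.
move=> xy; rewrite -subr_ge0 -degB -[_ - _]freeg_sumE raddf_sum /=.
by apply: sumr_ge0 => s _; rewrite degU coeffB subr_ge0.
Qed.

End AbelianLattice.

Section AbelianisationControlled.
Variables (S : choiceType) (E : rel S).
Hypotheses (E_sym : symmetric E) (E_irr : irreflexive E).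
Local Notation P := (raag_pos E).
Local Notation Q := (zsum_pos S).
Local Notation phi := (abelianisation E).
Import freeg.

Lemma abelianisation_pos x : P x -> Q (phi x).
Proof. by move=> /posgP[a ->] s; rewrite coeff_posg. Qed.

Lemma abelianisationV x : phi x^-1%g = (phi x)^-1%g.
Proof.
apply: (mulgI (phi x)); rewrite -abelianisationM !mulgV.
by apply: (mulgI (phi 1%g)); rewrite -abelianisationM !mulg1.
Qed.

Lemma abelianisation_le x y : pos_le P x y -> pos_le Q (phi x) (phi y).
Proof.
by move=> /abelianisation_pos; rewrite abelianisationM abelianisationV.
Qed.

(** Positive elements below [q] are spelled by words of length at most the degree of [q] in the
    finitely many letters of [dom q]. The whole interval is taken, not just the fibre over [q],
    because [small_support] bounds degrees only from above. *)
Lemma abelianisation_finite (q : zsum S) :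
  finite_set (P `&` [set x | pos_le Q (phi x) q]).
Proof.
pose A := [set a : seq S | (size a <= `|deg (q : {freeg S / int})|)%N
   /\ {subset a <= dom (q : {freeg S / int})}].
apply: (@sub_finite_set _ _ (posg E @` A)); last first.
  by apply: finite_image; exact: finite_bounded_words.
move=> _ [/posgP[a ->] /zsum_leP aq]; exists a => //; split.
  by have := deg_le aq; rewrite -/(degree (posg E a)) degree_posg; lia.
move=> s sa; rewrite mem_dom; have := aq s; rewrite coeff_posg.
by rewrite -has_pred1 has_count in sa; lia.
Qed.

(** By [join_disjoint] each coordinate of [phi z] equals that of [phi x] or of [phi y], so it lies
    below every common upper bound. *)
Lemma abelianisation_join x y z : P x -> P y -> is_join P x y z ->
  is_join Q (phi x) (phi y) (phi z).
Proof.
move=> Px Py xyz; have [xz yz _] := xyz.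
split; [exact: abelianisation_le|exact: abelianisation_le|].
move=> u /zsum_leP xu /zsum_leP yu; apply/zsum_leP => s.
have := xu s; have := yu s.
have := join_disjoint E_sym E_irr Px Py xyz s.
by rewrite !abelianisationM !abelianisationV !coefM !coefV; lia.
Qed.

Lemma abelianisation_controlled : controlled P Q phi.
Proof.
split; [exact: raag_quasi_lattice | exact: zsum_quasi_lattice
       | exact: abelianisationM | split].
- exact: abelianisation_le.
- move=> q _; apply: sub_finite_set (abelianisation_finite q) => x [Px /= ->].
  by split=> //; apply/zsum_leP.
- by move=> x y z Px Py; exact: abelianisation_join.
Qed.

End AbelianisationControlled.

(** * Topological preliminaries *)

Section ComplexTopology.
Variable R : realType.
Local Notation C := R[i].
Local Notation normc := Normc.normc.
Local Open Scope complex_scope.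

Lemma normc_norm (z : C) : `|z| = (normc z)%:C.
Proof. by case: z. Qed.

Lemma normc_ge0 (z : C) : 0 <= normc z.
Proof. by case: z => a b /=; exact: sqrtr_ge0. Qed.

Lemma normc_conj (z : C) : normc (z^*)%R = normc z.
Proof. by apply: (@complexI R); rewrite -!normc_norm norm_conjC. Qed.

Lemma conjc_mul_normc (z : C) : ((z^*) * z)%R = (normc z ^+ 2)%:C.
Proof. by rewrite mulrC -normCK normc_norm rmorphXn. Qed.

Lemma normc_real (x : R) : normc x%:C = `|x|.
Proof. by rewrite /= expr0n /= addr0 sqrtr_sqr. Qed.

Lemma normc_dist (z w : C) : `|normc z - normc w| <= normc (z - w).
Proof.
by have := ler_dist_dist z w; rewrite !normc_norm lecR -rmorphB normc_real.
Qed.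

(** Radii in [C^o] are themselves complex; positivity forces their imaginary part to vanish, which
    leaves a condition on the real-valued [normc]. *)
Lemma cvgCP (U : Type) (F : set_system U) {FF : Filter F} (f : U -> C^o) (l : C^o) :
  f @ F --> l <-> forall e : R, 0 < e -> \forall x \near F, normc (l - f x) < e.
Proof.
split=> [/cvgrPdist_lt fl e e0|fl].
  have := fl e%:C; rewrite ltcR => /(_ e0); apply: filterS => x.
  by rewrite normc_norm ltcR.
apply/cvgrPdist_lt => -[a b]; rewrite ltcE /= => /andP[/eqP -> a0].
have := fl a a0; apply: filterS => x; by rewrite normc_norm ltcR.
Qed.

Lemma cvg_normc (U : Type) (F : set_system U) {FF : Filter F} (f : U -> C^o) (l : C^o) :
  f @ F --> l -> (fun x => normc (f x)) @ F --> normc l.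
Proof.
move=> /cvgCP fl; apply/cvgrPdist_lt => e e0; have := fl e e0; apply: filterS => x.
exact: le_lt_trans (normc_dist _ _).
Qed.

Lemma cvg_real_complex (U : Type) (F : set_system U) {FF : Filter F} (f : U -> R) (l : R) :
  f @ F --> l -> (fun x => (f x)%:C : C^o) @ F --> (l%:C : C^o).
Proof.
move=> /cvgrPdist_lt fl; apply/cvgCP => e e0; have := fl e e0; apply: filterS => x.
by rewrite -rmorphB normc_real.
Qed.

Lemma cvg_conjc (U : Type) (F : set_system U) {FF : Filter F} (f : U -> C^o) (l : C^o) :
  f @ F --> l -> (fun x => (f x)^* : C^o)%R @ F --> (l^* : C^o)%R.
Proof.
move=> /cvgCP fl; apply/cvgCP => e e0; have := fl e e0; apply: filterS => x.
by rewrite -rmorphB normc_conj.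
Qed.

End ComplexTopology.

Lemma is_join_uniq (G : groupType) (P : set G) (x y z z' : G) :
  P `&` [set g | P g^-1%g] = [set 1%g] ->
  is_join P x y z -> is_join P x y z' -> z = z'.
Proof.
move=> PI [xz yz zmin] [xz' yz' zmin'].
have zz' : pos_le P z z' by exact: zmin.
have z'z : pos_le P z' z by exact: zmin'.
have : (P `&` [set g | P g^-1%g]) (z^-1 * z')%g by split=> //=; rewrite invgM invgK.
by rewrite PI => /mulg1_eq; rewrite invgK.
Qed.

(** * Topology of the Nica spectrum *)

Section SubsetTopology.
Variable G : groupType.
Local Notation T := (subsets G).

Lemma eval_continuous (t : G) : continuous (fun w : T => w t).
Proof. exact: (@proj_continuous G (fun=> bool)). Qed.

Lemma near_mem (t : G) (w : T) : w t -> \forall v \near w, (v : T) t.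
Proof.
move=> wt; have := @eval_continuous t w [set b : bool | b]; apply.
by apply: open_nbhs_nbhs; split=> //; exact: discrete_open.
Qed.

Lemma near_notin (t : G) (w : T) : ~~ w t -> \forall v \near w, ~~ (v : T) t.
Proof.
move=> wt; have := @eval_continuous t w [set b : bool | ~~ b]; apply.
by apply: open_nbhs_nbhs; split=> //; exact: discrete_open.
Qed.

Lemma translate_continuous (t : G) : continuous (@translate G t : T -> T).
Proof.
move=> w; apply/cvg_sup => s.
have h : continuous (@translate G t : T -> initial_topology (fun v : T => v s)).
  by apply: continuous_comp_initial => v; exact: eval_continuous.
exact: h.
Qed.

Lemma subsets_compact : compact [set: T].
Proof.
have := @tychonoff G (fun=> bool) (fun=> setT) (fun=> bool_compact).
by congr (compact _); apply/seteqP; split.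
Qed.

Lemma closed_subsets_mem (t : G) : closed [set w : T | w t].
Proof.
move=> w; have [//|/near_notin nw] := boolP (w t) => clw.
by have [v [/= vt]] := clw _ nw; rewrite vt.
Qed.

(** Uniqueness of joins makes directedness a closed condition: the join found at one point near [w]
    is the only candidate, and if [w] missed it, a nearby point of the spectrum would miss it
    too. *)
Lemma nica_spectrum_closed (P : set G) :
  (forall x y z z', is_join P x y z -> is_join P x y z' -> z = z') ->
  closed (nica_spectrum P : set T).
Proof.
move=> joinI w clw; split.
- by apply: (closed_subsets_mem (t := 1%g)) => A /clw[v [[]]]; exists v.
- move=> x p wx Pp; apply/negPn/negP => wxp.
  have [v [[_ /(_ x p) h _] [/= vx vxp]]] := clw _ (filterI (near_mem wx) (near_notin wxp)).
  by rewrite h in vxp.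
- move=> x y wx wy.
  have [v [[_ _ /(_ x y) h] [/= vx vy]]] := clw _ (filterI (near_mem wx) (near_mem wy)).
  have [z xyz vz] := h vx vy; exists z => //.
  apply/negPn/negP => wz.
  have [u [[_ _ /(_ x y) k] [[/= ux uy] uz]]] :=
    clw _ (filterI (filterI (near_mem wx) (near_mem wy)) (near_notin wz)).
  have [z' /(joinI _ _ _ _ xyz) <- uz'] := k ux uy.
  by rewrite uz' in uz.
Qed.

End SubsetTopology.

(** * Elementary inequalities *)

Lemma sum_indic_le (R : numDomainType) (I : eqType) (r : seq I) (i0 : I) (y : R) :
  uniq r -> 0 <= y -> \sum_(i <- r) (if i == i0 then y else 0) <= y.
Proof.
move=> ur y0; rewrite -big_mkcond /=; have [ri|ri] := boolP (i0 \in r).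
  by rewrite (big_rem _ ri) /= eqxx big_seq_cond big1 ?addr0 // => i /andP[];
    rewrite mem_rem_uniq // inE => /andP[/negbTE ->].
by rewrite big_seq_cond big1 // => i /andP[ir /eqP ii]; rewrite ii (negbTE ri) in ir.
Qed.

Lemma sup_ge0 (R : realType) (B : set R) : (forall x, B x -> 0 <= x) -> 0 <= sup B.
Proof.
move=> B0; have [[[x Bx] ubB]|nB] := pselect (has_sup B); last by rewrite sup_out.
by apply: le_trans (B0 x Bx) _; exact: ub_le_sup.
Qed.

Lemma bernoulli_ge (R : realFieldType) (h : R) n : 0 <= h -> n%:R * h <= (1 + h) ^+ n.
Proof.
move=> h0; elim: n => [|n IH]; first by rewrite mul0r expr0.
have h1 : 1 <= (1 + h) ^+ n by rewrite exprn_ege1 // lerDl.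
rewrite exprS mulrDl mul1r -natr1 mulrDl mul1r lerD //.
by rewrite -{1}[h]mulr1 ler_wpM2l.
Qed.

(** If [x > y], then [(x / y) ^+ (2 ^ k)] is exponential in [2 ^ k] and outruns every fixed power of
    it. *)
Lemma poly_power_bound (R : archiRealFieldType) (x y c : R) d : 0 <= x -> 0 <= y ->
  (forall k, x ^+ (2 ^ k) <= c * (2 ^ k).+1%:R ^+ d * y ^+ (2 ^ k)) -> x <= y.
Proof.
move=> x0 y0 xy; rewrite leNgt; apply/negP => yx.
have xp : 0 < x by exact: le_lt_trans yx.
have yp : 0 < y.
  rewrite lt_def y0 andbT; apply: contraTneq (xy 0%N) => ->.
  by rewrite expr1 mulr0 -ltNge.
pose h := x / y - 1.
have hp : 0 < h by rewrite subr_gt0 ltr_pdivlMr // mul1r.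
have hE : x / y = 1 + h by rewrite /h addrC subrK.
have key k : (1 + h) ^+ (2 ^ k) <= c * (2 ^ k).+1%:R ^+ d.
  by rewrite -hE expr_div_n ler_pdivrMr ?exprn_gt0.
have cp : 0 < c.
  have := key 0%N; rewrite expr1 => /(lt_le_trans (addr_gt0 ltr01 hp)).
  by rewrite pmulr_lgt0 // exprn_gt0.
(* An exponent above [d] that is a power of two, so that [k = j + d] gives [2 ^ k = 2 ^ j * N]. The
   [N]-th power of Bernoulli's inequality then beats the power [d] by at least a factor [2 ^ j]. *)
pose N := (2 ^ d)%N.
have Nd : (d < N)%N by exact: ltn_expl.
have bound j : h ^+ N * (2 ^ j)%:R <= c * (N.*2)%:R ^+ d.
  have m1 : 1 <= (2 ^ j)%:R :> R by rewrite ler1n expn_gt0.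
  have mp : 0 < (2 ^ j)%:R :> R by rewrite ltr0n expn_gt0.
  have : ((2 ^ j)%:R * h) ^+ N <= c * (N.*2)%:R ^+ d * (2 ^ j)%:R ^+ d.
    apply: (@le_trans _ _ ((1 + h) ^+ (2 ^ (j + d)))).
      rewrite expnD exprM lerXn2r ?nnegrE ?bernoulli_ge ?ltW //.
        by rewrite mulr_gt0.
      by rewrite exprn_gt0 // addr_gt0.
    apply: le_trans (key _) _; rewrite -mulrA ler_pM2l // -exprMn -natrM.
    rewrite lerXn2r ?nnegrE // ler_nat expnD -/N -addnn.
    have := expn_gt0 2 j; have := expn_gt0 2 d; rewrite -/N /=; nia.
  rewrite exprMn mulrC => /(le_trans _) h1.
  have {}h1 : h ^+ N * (2 ^ j)%:R * (2 ^ j)%:R ^+ d <= c * (N.*2)%:R ^+ d * (2 ^ j)%:R ^+ d.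
    apply: h1; rewrite -mulrA ler_wpM2l //; first by rewrite exprn_ge0 // ltW.
    by rewrite -exprS; exact: ler_weXn2l.
  by rewrite -(ler_pM2r (exprn_gt0 d mp)).
pose b := c * (N.*2)%:R ^+ d / h ^+ N.
have := archi_boundP (x := `|b|) (normr_ge0 _); set j := Num.bound _ => bj.
have := bound j; rewrite mulrC -ler_pdivlMr ?exprn_gt0 // -/b => jb.
have : (2 ^ j)%:R < j%:R :> R.
  by apply: le_lt_trans bj; apply: le_trans jb (ler_norm _).
by rewrite ltr_nat ltnNge ltnW // ltn_expl.
Qed.

(** * The crossed product and its norms *)

Section CrossedProduct.
Variables (R : realType) (G : groupType) (P : set G) (X : set (subsets G)).
Hypotheses (XP : X `<=` nica_spectrum P) (Xcl : closed X).
Hypothesis Xinv : nica_invariant P X.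
Local Notation T := (subsets G).
Local Notation C := R[i].
Local Notation normc := Normc.normc.
Local Notation D := (cp_dom P X).
Local Notation A := (@cp_alg R G P X).
Local Notation norm := (@reduced_norm R G P X).
Local Notation mul := (@cp_mul R G P X).
Local Notation star := (@cp_star R G P X).

Lemma compact_X : compact X.
Proof. by apply: (subclosed_compact Xcl (@subsets_compact G)). Qed.

Lemma translateM (s t : G) (w : T) :
  translate s (translate t w) = translate (s * t)%g w.
Proof. by apply/funext => g; rewrite /translate invgM mulgA. Qed.

Lemma translate1 (w : T) : translate 1%g w = w.
Proof. by apply/funext => g; rewrite /translate invg1 mul1g. Qed.

Lemma translateK (t : G) (w : T) : translate t (translate t^-1%g w) = w.
Proof. by rewrite translateM mulgV translate1. Qed.

Lemma X_one (w : T) : X w -> w 1%g.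
Proof. by move=> /XP[]. Qed.

Lemma cp_domP (t : G) (w : T) : D t w <-> X w /\ w t.
Proof.
split=> [[[_ wt] Xw]//|[Xw wt]]; split=> //; split=> //; exact: XP.
Qed.

Lemma X_translate (t : G) (w : T) : X w -> w t^-1%g -> X (translate t w).
Proof.
by move=> Xw wt; apply: (@Xinv t); exists w => //; split=> //; split=> //; exact: XP.
Qed.

Lemma cp_dom_translate (t : G) (w : T) : D t^-1%g w -> D t (translate t w).
Proof.
move=> /cp_domP[Xw wt]; apply/cp_domP; split; first exact: X_translate.
by rewrite /translate mulVg; exact: X_one.
Qed.

Lemma cp_domV (t : G) (w : T) : D t^-1%g (translate t^-1%g w) <-> D t w.
Proof.
split; last by rewrite -{1}[t]invgK; exact: cp_dom_translate.
by move=> /cp_dom_translate; rewrite translateK.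
Qed.

(** * Continuity on [X] and the algebra of finite sums *)

Definition ctsX (f : T -> C) : Prop :=
  forall w, X w -> (f : T -> C^o) @ within X (nbhs w) --> (f w : C^o).

Lemma ctsX_cst0 (f : T -> C) (t : G) (w : T) :
  (forall v, ~ D t v -> f v = 0) -> X w -> ~~ w t ->
  (f : T -> C^o) @ within X (nbhs w) --> (f w : C^o).
Proof.
move=> f0 Xw /[dup] wt /near_notin nwt.
have ft v : ~~ (v : T) t -> f v = 0 by move=> /negP nvt; apply: f0 => /cp_domP[].
rewrite (ft w) //; apply: cvg_near_cst.
by apply: cvg_within; apply: filterS nwt => v; exact: ft.
Qed.

(** [D t] is clopen in the compact set [X], so vanishing at infinity is automatic and the extension
    by zero stays continuous on [X]. *)
Lemma C0P (t : G) (f : T -> C) :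
  C0 (D t) f <-> ctsX f /\ forall w, ~ D t w -> f w = 0.
Proof.
split=> [[/subspace_continuousP fc _ f0]|[fc f0]].
  split=> // w Xw; have [wt|nwt] := boolP (w t); last exact: (ctsX_cst0 f0).
  apply: cvg_trans (fc w _); last exact/cp_domP.
  apply: cvg_app => B nB; change (\forall v \near w, X v -> B v).
  have {}nB : \forall v \near w, D t v -> B v by exact: nB.
  apply: filterS2 nB (near_mem wt) => v h vt Xv; apply: h.
  exact/cp_domP.
split=> //.
- apply/subspace_continuousP => w /cp_domP[Xw wt].
  apply: cvg_trans (fc w Xw); apply: cvg_app => B nB.
  change (\forall v \near w, D t v -> B v).
  have {}nB : \forall v \near w, X v -> B v by exact: nB.
  by apply: filterS nB => v h [_ Xv]; exact: h.
- move=> e e0; apply: (subclosed_compact _ compact_X); last by move=> w [[_ ]].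
  move=> w clw; have Xw : X w.
    by apply: Xcl => B /clw[v [[[_ Xv] _] Bv]]; exists v.
  have wt : w t.
    by apply: (closed_subsets_mem (t := t)) => B /clw[v [[/cp_domP[_ vt] _] Bv]]; exists v.
  split; first exact/cp_domP.
  rewrite /= leNgt; apply/negP => fe.
  have /cvg_normc/cvgrPdist_lt/(_ (e - normc (f w))) := fc w Xw.
  rewrite subr_gt0 => /(_ fe); rewrite /prop_near1 /within /= => /clw.
  move=> [v [[/cp_domP[Xv _] /= ev] /(_ Xv)]].
  by rewrite ltr_norml; lra.
Qed.

Lemma cp_algP (a : G -> T -> C) : A a <->
  [/\ finite_set [set t | a t != 0], forall t, ctsX (a t)
    & forall t w, ~ D t w -> a t w = 0].
Proof.
split=> [[fa ca]|[fa ca a0]].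
  by split=> // t; have /C0P[] := ca t.
by split=> // t; apply/C0P; split=> //; exact: a0.
Qed.

Lemma ctsX0 : ctsX (fun=> 0).
Proof. by move=> w _; exact: cvg_cst. Qed.

Lemma ctsXD f g : ctsX f -> ctsX g -> ctsX (fun w => f w + g w).
Proof. by move=> cf cg w Xw; apply: (@cvgD C C^o); [exact: cf|exact: cg]. Qed.

Lemma ctsXM f g : ctsX f -> ctsX g -> ctsX (fun w => f w * g w).
Proof. by move=> cf cg w Xw; apply: (@cvgM C); [exact: cf|exact: cg]. Qed.

Lemma ctsXZ (c : C) f : ctsX f -> ctsX (fun w => c * f w).
Proof.
move=> cf; have cc : ctsX (fun=> c) by move=> w _; exact: cvg_cst.
exact: (ctsXM cc cf).
Qed.

Lemma ctsX_sum (I : Type) (r : seq I) (F : I -> T -> C) :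
  (forall i, ctsX (F i)) -> ctsX (fun w => \sum_(i <- r) F i w).
Proof.
move=> cF; elim: r => [|i r IH].
  by under eq_fun do rewrite big_nil; exact: ctsX0.
under eq_fun do rewrite big_cons; exact: (ctsXD (cF i) IH).
Qed.

Lemma cvg_translate_within (s : G) (w : T) : X w -> w s ->
  translate s^-1%g @ within X (nbhs w) -->
  within X (nbhs (translate s^-1%g w : T)).
Proof.
move=> Xw ws B nB.
change (\forall v \near w, X v -> B (translate s^-1%g v)).
have {}nB : \forall v \near translate s^-1%g w, X v -> B v by exact: nB.
have h : \forall v \near w, X (translate s^-1%g v) -> B (translate s^-1%g v).
  exact: (@translate_continuous G s^-1%g w _ nB).
apply: filterS2 h (near_mem ws) => v /= h vs Xv; apply: h.
by apply: X_translate => //; rewrite invgK.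
Qed.

Lemma ctsX_shift f g (s : G) : ctsX f -> (forall w, ~ D s w -> f w = 0) ->
  ctsX g -> ctsX (fun w => f w * g (translate s^-1%g w)).
Proof.
move=> cf f0 cg w Xw; have [ws|nws] := boolP (w s).
  apply: (@cvgM C); first exact: cf.
  apply: (cvg_comp _ _ (cvg_translate_within Xw ws)); apply: cg.
  by apply: X_translate => //; rewrite invgK.
by apply: (ctsX_cst0 (t := s)) => // v /f0 ->; rewrite mul0r.
Qed.

Lemma ctsX_dom1 (t : G) : ctsX (fun w => if w \in D t then 1 else 0).
Proof.
move=> w Xw; have [wt|nwt] := boolP (w t); last first.
  by apply: (ctsX_cst0 (t := t)) => // v nv; rewrite memNset.
apply: cvg_near_cst; apply: filterS (near_mem wt) => v vt Xv.
by rewrite !mem_set //; apply/cp_domP.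
Qed.

Lemma ctsX_star f (t : G) : ctsX f -> (forall w, ~ D t^-1%g w -> f w = 0) ->
  ctsX (fun w => (f (translate t^-1%g w))^*).
Proof.
move=> cf f0 w Xw; have [wt|nwt] := boolP (w t).
  apply: cvg_conjc; apply: (cvg_comp _ _ (cvg_translate_within Xw wt)); apply: cf.
  by apply: X_translate => //; rewrite invgK.
apply: (ctsX_cst0 (t := t)) => // v nvt; rewrite f0 ?conjC0 //.
by move=> /cp_domV.
Qed.

Lemma ctsX_bounded f : ctsX f -> exists2 M, 0 <= M & forall w, X w -> normc (f w) <= M.
Proof.
move=> cf.
have ccf : {within X, continuous (fun w => normc (f w))}.
  by apply/subspace_continuousP => w Xw; apply: cvg_normc; exact: cf.
have /compact_bounded[M [_ hM]] := continuous_compact ccf compact_X.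
exists (`|M| + 1); first by rewrite addr_ge0.
move=> w Xw; have /(_ _) := hM (`|M| + 1).
have M1 : M < `|M| + 1 by rewrite (le_lt_trans (ler_norm _)) // ltrDl.
move=> /(_ M1 (normc (f w))) h; apply: le_trans (h _); first exact: ler_norm.
by exists w.
Qed.

(* Products and adjoints in the algebra, without the restrictions of the
   domains: these are automatic as each coefficient vanishes off its domain. *)
Lemma cp_mulE (a b : G -> T -> C) (r : G) (w : T) : A a ->
  cp_mul P X a b r w =
  \sum_(s \in [set: G]) a s w * b (s^-1 * r)%g (translate s^-1%g w).
Proof.
move=> /cp_algP[_ _ a0]; rewrite /cp_mul; apply: eq_fsbigr => s _.
rewrite /cp_act; case: ifPn => [/set_mem ws|/negP ws]; last first.
  by rewrite a0 ?mul0r // => /mem_set.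
by rewrite mem_set; [rewrite invgK translateK|exact/cp_domV].
Qed.

Lemma cp_starE (a : G -> T -> C) (t : G) (w : T) : A a ->
  cp_star P X a t w = (a t^-1%g (translate t^-1%g w))^*.
Proof.
move=> /cp_algP[_ _ a0]; rewrite /cp_star /cp_act; case: ifPn => // /negP wt.
by rewrite a0 ?conjC0 // => /cp_domV/mem_set.
Qed.

Definition cp_supp (a : G -> T -> C) : seq G := fset_set [set t | a t != 0].

Lemma cp_supp_uniq a : uniq (cp_supp a).
Proof. exact: fset_uniq. Qed.

Lemma mem_cp_supp a t : A a -> (t \in cp_supp a) = (a t != 0).
Proof.
move=> /cp_algP[fa _ _]; rewrite in_fset_set //.
by apply/idP/idP => [/set_mem|]; last exact: mem_set.
Qed.

Lemma cp_supp0 a t : A a -> t \notin cp_supp a -> a t = 0.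
Proof. by move=> Aa; rewrite mem_cp_supp // negbK => /eqP. Qed.

Lemma fsum_seq (K : seq G) (F : G -> C) : uniq K ->
  (forall s, s \notin K -> F s = 0) ->
  \sum_(s \in [set: G]) F s = \sum_(s <- K) F s.
Proof.
move=> uK F0; rewrite (fsbigE K) // => [|s _ sK]; last exact: F0.
by apply: eq_bigl => s; rewrite in_setT.
Qed.

Lemma cp_mul_support (a b : G -> T -> C) (r : G) (w : T) : A a ->
  cp_mul P X a b r w =
  \sum_(s <- cp_supp a) a s w * b (s^-1 * r)%g (translate s^-1%g w).
Proof.
move=> Aa; rewrite cp_mulE //; apply: fsum_seq; first exact: cp_supp_uniq.
by move=> s /(cp_supp0 Aa) ->; rewrite mul0r.
Qed.

Lemma cp_mul_neq0 a b r w : A a -> cp_mul P X a b r w != 0 ->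
  exists s, a s w != 0 /\ b (s^-1 * r)%g (translate s^-1%g w) != 0.
Proof.
move=> Aa; rewrite cp_mul_support // => h; apply: contrapT => nex; move: h.
rewrite big1 ?eqxx // => s _; apply/eqP; rewrite mulf_eq0.
by apply/negPn/negP; rewrite negb_or => /andP[? ?]; apply: nex; exists s.
Qed.

Lemma cp_algM a b : A a -> A b -> A (cp_mul P X a b).
Proof.
move=> Aa Ab; have /cp_algP[fa ca a0] := Aa; have /cp_algP[fb cb b0] := Ab.
have nz t : cp_mul P X a b t != 0 -> exists w, cp_mul P X a b t w != 0.
  move=> h; apply: contrapT => nex; move/eqP: h; apply; apply/funext => w.
  by apply/eqP/negPn/negP => h; apply: nex; exists w.
apply/cp_algP; split.
- apply: (@sub_finite_set _ _ ((fun p => (p.1 * p.2)%g) @`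
    ([set t | a t != 0] `*` [set t | b t != 0]))); last first.
    exact/finite_image/finite_setX.
  move=> t /nz[w /(cp_mul_neq0 Aa)[s [aw bw]]].
  exists (s, s^-1 * t)%g => /=; last by rewrite mulVKg.
  by split=> /=; [apply: contraNneq aw => ->|apply: contraNneq bw => ->].
- move=> t; have -> : cp_mul P X a b t = fun w => \sum_(s <- cp_supp a)
      a s w * b (s^-1 * t)%g (translate s^-1%g w).
    by apply/funext => w; exact: cp_mul_support.
  by apply: ctsX_sum => s; apply: (ctsX_shift (ca s) _ (cb _)); exact: a0.
- move=> t w nw; apply/eqP/negPn/negP => /(cp_mul_neq0 Aa)[s [aw bw]]; apply: nw.
  have /cp_domP[Xw ws] : D s w by apply: contrapT => /a0 ?; move/eqP: aw; apply.
  have /cp_domP[_ wt] : D (s^-1 * t)%g (translate s^-1%g w).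
    by apply: contrapT => /b0 ?; move/eqP: bw; apply.
  by apply/cp_domP; split=> //; move: wt; rewrite /translate invgK mulVKg.
Qed.

Lemma cp_algS a : A a -> A (cp_star P X a).
Proof.
move=> Aa; have /cp_algP[fa ca a0] := Aa.
have sE t : cp_star P X a t = fun w => (a t^-1%g (translate t^-1%g w))^*.
  by apply/funext => w; exact: cp_starE.
apply/cp_algP; split.
- apply: (@sub_finite_set _ _ ((fun t => t^-1%g) @` [set t | a t != 0])); last first.
    exact: finite_image.
  move=> t /= h; exists t^-1%g; last by rewrite invgK.
  apply: contraNneq h => /= at0; rewrite sE at0.
  by apply/eqP/funext => w /=; rewrite conjC0.
- by move=> t; rewrite sE; apply: ctsX_star => //; exact: a0.
- move=> t w nw; rewrite sE a0 ?conjC0 //.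
  by move=> /cp_domV.
Qed.

Lemma cp_algD a b : A a -> A b -> A (a + b).
Proof.
move=> /cp_algP[fa ca a0] /cp_algP[fb cb b0]; apply/cp_algP; split.
- apply: (@sub_finite_set _ _ ([set t | a t != 0] `|` [set t | b t != 0])).
    move=> t /=; rewrite fctE => h; apply: contrapT => /not_orP[/negP].
    rewrite negbK => /eqP at0 /negP; rewrite negbK => /eqP bt0.
    by move: h; rewrite at0 bt0 addr0 eqxx.
  by rewrite finite_setU.
- by move=> t; exact: ctsXD.
- by move=> t w nw; rewrite !fctE a0 // b0 // addr0.
Qed.

Lemma cp_algZ c a : A a -> A (cp_scale c a).
Proof.
move=> /cp_algP[fa ca a0]; apply/cp_algP; split.
- apply: sub_finite_set fa => t /=; apply: contraNneq => at0.
  by apply/eqP/funext => w; rewrite /cp_scale at0 mulr0.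
- by move=> t; exact: ctsXZ.
- by move=> t w nw; rewrite /cp_scale a0 // mulr0.
Qed.

Lemma cp_alg0 : A 0.
Proof.
apply/cp_algP; split=> // [|t]; last exact: ctsX0.
by rewrite (_ : mkset _ = set0) //; apply/seteqP; split=> t //=; rewrite eqxx.
Qed.

Lemma cp_algN a : A a -> A (- a).
Proof.
have -> : - a = cp_scale (-1) a.
  by apply/funext => t; apply/funext => w; rewrite /cp_scale mulN1r.
exact: cp_algZ.
Qed.

Lemma cp_algB a b : A a -> A b -> A (a - b).
Proof. by move=> Aa Ab; apply: cp_algD => //; exact: cp_algN. Qed.

Definition delta (t : G) (f : T -> C) : G -> T -> C :=
  fun s w => if s == t then f w else 0.

Lemma cp_alg_delta t f : ctsX f -> (forall w, ~ D t w -> f w = 0) ->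
  A (delta t f).
Proof.
move=> cf f0; apply/cp_algP; split.
- apply: (@sub_finite_set _ _ [set t]) => // s /=; apply: contra_neqP => st.
  by apply/funext => w; rewrite /delta; case: eqP.
- by move=> s; rewrite /delta; case: eqP => _; [exact: cf|exact: ctsX0].
- by move=> s w; rewrite /delta; case: eqP => // ->; exact: f0.
Qed.

(** * The regular representation and the reduced norm *)

Section RegularRepresentation.
Implicit Types (a b : G -> T -> C) (w : T) (K L M : seq G) (x v : G -> C) (c d : R).

(* The matrix of [a] in the regular representation on l^2 of the orbit of [w]:
   it vanishes automatically unless [r^-1] and [u^-1] belong to [w]. *)
Definition mat a w (r u : G) : C := a (r * u^-1)%g (translate r w).

Definition sqn K v : R := \sum_(u <- K) normc (v u) ^+ 2.

Definition mxapp a w K v r : C := \sum_(u <- K) mat a w r u * v u.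

Definition bform a w L K x v : C := \sum_(r <- L) x r * mxapp a w K v r.

(* The regular representations bound [a] by [c].  By homogeneity the arithmetic
   mean may replace the product of the norms of [x] and [v]; this makes the
   condition visibly additive and self-adjoint. *)
Definition bounded_by a c : Prop := forall w, X w -> forall L K x v,
  uniq L -> uniq K -> 2 * normc (bform a w L K x v) <= c * (sqn L x + sqn K v).

Definition op_bounded_by a c : Prop := forall w, X w -> forall L K v,
  uniq L -> uniq K -> sqn L (mxapp a w K v) <= c ^+ 2 * sqn K v.

Lemma sqn_ge0 K v : 0 <= sqn K v.
Proof. by apply: sumr_ge0 => u _; exact: sqr_ge0. Qed.

Lemma normc_sum (I : Type) (r : seq I) (F : I -> C) :
  normc (\sum_(i <- r) F i) <= \sum_(i <- r) normc (F i).
Proof.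
elim/big_ind2: _ => // [|y1 z1 y2 z2 h1 h2]; first by rewrite Normc.normc0.
exact: le_trans (le_normcD _ _) (lerD h1 h2).
Qed.

(** Testing with the conjugate of the image vector scaled by [c^-1] gives the operator bound; the
    inequality of means with weights [c] and [c^-1] gives the converse. The case [c = 0] is
    separate. *)
Lemma bounded_byP a c : 0 <= c -> bounded_by a c <-> op_bounded_by a c.
Proof.
move=> c0; split=> ha w Xw L K.
  move=> v uL uK; set y := mxapp a w K v.
  have key s : 0 <= s -> 2 * s * sqn L y <= c * (s ^+ 2 * sqn L y + sqn K v).
    move=> s0; have := ha w Xw L K (fun r => s%:C%C * (y r)^*) v uL uK.
    have -> : bform a w L K (fun r => s%:C%C * (y r)^*) v = (s * sqn L y)%:C%C.
      rewrite rmorphM rmorph_sum mulr_sumr; apply: eq_bigr => r _ /=.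
      by rewrite -mulrA conjc_mul_normc.
    have -> : sqn L (fun r => s%:C%C * (y r)^*) = s ^+ 2 * sqn L y.
      rewrite mulr_sumr; apply: eq_bigr => r _.
      by rewrite Normc.normcM normc_conj normc_real exprMn real_normK ?num_real.
    by rewrite normc_real ger0_norm ?mulrA // mulr_ge0 // sqn_ge0.
  have y0 := sqn_ge0 L y.
  have [c00|cn] := eqVneq c 0.
    by have := key 1 ler01; rewrite c00 expr0n !mul0r; lra.
  have cp : 0 < c by rewrite lt_def cn.
  have /(ler_wpM2l c0) : 2 * c^-1 * sqn L y <= c * (c^-1 ^+ 2 * sqn L y + sqn K v).
    by apply: key; rewrite invr_ge0.
  have -> : c * (2 * c^-1 * sqn L y) = 2 * sqn L y by field.
  have -> : c * (c * (c^-1 ^+ 2 * sqn L y + sqn K v)) = sqn L y + c ^+ 2 * sqn K v.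
    by field.
  by lra.
move=> x v uL uK; have := ha w Xw L K v uL uK.
set y := mxapp a w K v => yle.
have : 2 * normc (bform a w L K x v) <= \sum_(r <- L) 2 * (normc (x r) * normc (y r)).
  rewrite -mulr_sumr ler_pM2l //; apply: le_trans (normc_sum _ _) _.
  by apply: ler_sum => r _; rewrite Normc.normcM.
move=> /le_trans; apply; have [c00|cn] := eqVneq c 0.
  rewrite c00 mul0r; rewrite c00 expr0n mul0r in yle.
  rewrite big_seq big1 // => r rL; suff -> : normc (y r) = 0 by rewrite !mulr0.
  apply/eqP; rewrite -sqrf_eq0 eq_le sqr_ge0 andbT; apply: le_trans yle.
  rewrite /sqn (big_rem _ rL) /= lerDl; exact: sqn_ge0.
have cp : 0 < c by rewrite lt_def cn.
have h r : 2 * (normc (x r) * normc (y r)) <= c * normc (x r) ^+ 2 + c^-1 * normc (y r) ^+ 2.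
  rewrite -subr_ge0.
  have -> : c * normc (x r) ^+ 2 + c^-1 * normc (y r) ^+ 2 -
     2 * (normc (x r) * normc (y r)) = c^-1 * (c * normc (x r) - normc (y r)) ^+ 2.
    by field.
  by rewrite mulr_ge0 ?sqr_ge0 ?invr_ge0.
apply: le_trans (ler_sum _ (fun r _ => h r)) _.
rewrite big_split -!mulr_sumr mulrDr lerD2l.
apply: le_trans (ler_wpM2l _ yle) _; first by rewrite invr_ge0.
by rewrite expr2 !mulrA mulVf // mul1r.
Qed.

Lemma bounded_byD a b c d :
  bounded_by a c -> bounded_by b d -> bounded_by (a + b) (c + d).
Proof.
move=> ac bd w Xw L K x v uL uK.
have -> : bform (a + b) w L K x v = bform a w L K x v + bform b w L K x v.
  rewrite /bform -big_split /=; apply: eq_bigr => r _; rewrite -mulrDr; congr (_ * _).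
  by rewrite /mxapp -big_split /=; apply: eq_bigr => u _; rewrite -mulrDl.
apply: (@le_trans _ _ (2 * (normc (bform a w L K x v) + normc (bform b w L K x v)))).
  by rewrite ler_pM2l // le_normcD.
by rewrite mulrDr [X in _ <= X]mulrDl lerD //; [exact: ac|exact: bd].
Qed.

Lemma bounded_by0 : bounded_by 0 0.
Proof.
move=> w Xw L K x v uL uK; rewrite mul0r /bform big1 ?Normc.normc0 ?mulr0 // => r _.
by rewrite /mxapp big1 ?mulr0 // => u _; rewrite /mat mul0r.
Qed.

Lemma bounded_by_sum (I : Type) (r : seq I) (F : I -> G -> T -> C) (f : I -> R) :
  (forall i, bounded_by (F i) (f i)) ->
  bounded_by (\sum_(i <- r) F i) (\sum_(i <- r) f i).
Proof.
move=> h; elim/big_ind2: _ => //; [exact: bounded_by0|move=> ? ? ? ?; exact: bounded_byD].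
Qed.

Lemma bounded_byZ (z : C) a c : bounded_by a c -> bounded_by (cp_scale z a) (normc z * c).
Proof.
move=> ac w Xw L K x v uL uK.
have -> : bform (cp_scale z a) w L K x v = z * bform a w L K x v.
  rewrite /bform mulr_sumr; apply: eq_bigr => r _; rewrite mulrCA; congr (_ * _).
  by rewrite mulr_sumr; apply: eq_bigr => u _; rewrite mulrA.
by rewrite Normc.normcM mulrCA -mulrA ler_wpM2l ?normc_ge0 //; exact: ac.
Qed.

Lemma bounded_by_star a c : A a -> bounded_by a c -> bounded_by (cp_star P X a) c.
Proof.
move=> Aa ac w Xw L K x v uL uK.
have -> : bform (cp_star P X a) w L K x v =
    (bform a w K L (fun u => (v u)^*) (fun r => (x r)^*))^*.
  rewrite /bform /mxapp rmorph_sum /=; under eq_bigr do rewrite mulr_sumr.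
  rewrite exchange_big; apply: eq_bigr => u _; rewrite rmorphM /= conjCK.
  rewrite rmorph_sum mulr_sumr; apply: eq_bigr => r _ /=.
  rewrite rmorphM /= conjCK /mat cp_starE // translateM invgM invgK mulgVK.
  by ring.
rewrite normc_conj addrC; have := ac w Xw K L (fun u => (v u)^*) (fun r => (x r)^*) uK uL.
by rewrite /sqn; under eq_bigr do rewrite normc_conj;
  under [X in _ * (_ + X)]eq_bigr do rewrite normc_conj.
Qed.

(** Multiplicativity of the regular representation, by the substitution [s = r q^-1]. Keeping [M]
    arbitrary lets all columns [u] of a finite set share one list of intermediate indices. *)
Lemma mat_mul a b w r u M : A a -> uniq M ->
  (forall q, q \notin M -> mat b w q u = 0) ->
  mat (cp_mul P X a b) w r u = \sum_(q <- M) mat a w r q * mat b w q u.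
Proof.
move=> Aa uM M0; rewrite {1}/mat cp_mulE //.
rewrite (reindex_fsbigT (fun q => r * q^-1)%g) /=; last first.
  exists (fun s => s^-1 * r)%g => [q|s]; first by rewrite invgM invgK mulgVK.
  by rewrite invgM invgK mulVKg.
rewrite (fsum_seq uM) => [|q /M0 bq].
  apply: eq_bigr => q _; rewrite /mat; congr (_ * _).
  by rewrite translateM invgM invgK mulgVK mulgA mulgVK.
rewrite translateM invgM invgK mulgVK mulgA mulgVK.
by rewrite -[X in _ * X]/(mat b w q u) bq mulr0.
Qed.

Definition hull a K := undup [seq (t * u)%g | t <- cp_supp a, u <- K].

Lemma mat_hull a w q u K : A a -> u \in K -> q \notin hull a K -> mat a w q u = 0.
Proof.
move=> Aa uK; rewrite mem_undup => qK; rewrite /mat (cp_supp0 Aa) //.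
apply: contra qK => qu; apply/allpairsP; exists (q * u^-1, u)%g; split=> //=.
by rewrite mulgVK.
Qed.

Lemma mxapp_mul a b w K v r M : A a -> uniq M ->
  (forall u q, u \in K -> q \notin M -> mat b w q u = 0) ->
  mxapp (cp_mul P X a b) w K v r = mxapp a w M (mxapp b w K v) r.
Proof.
move=> Aa uM M0; rewrite /mxapp; under [RHS]eq_bigr do rewrite mulr_sumr.
rewrite exchange_big /= big_seq [RHS]big_seq; apply: eq_bigr => u uK.
rewrite (mat_mul _ Aa uM) => [|q]; last exact: M0.
by rewrite mulr_suml; apply: eq_bigr => q _; rewrite mulrA.
Qed.

Lemma bounded_byM a b c d : A a -> A b -> 0 <= c -> 0 <= d ->
  bounded_by a c -> bounded_by b d -> bounded_by (cp_mul P X a b) (c * d).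
Proof.
move=> Aa Ab c0 d0 /(bounded_byP _ c0) ac /(bounded_byP _ d0) bd.
apply/bounded_byP; first exact: mulr_ge0.
move=> w Xw L K v uL uK.
have uM : uniq (hull b K) by exact: undup_uniq.
rewrite {1}/sqn; under eq_bigr => r _.
  rewrite (mxapp_mul _ _ Aa uM); last by move=> u q; exact: mat_hull.
  over.
apply: le_trans (ac w Xw L _ _ uL uM) _.
by rewrite exprMn -[X in _ <= X]mulrA ler_wpM2l ?sqr_ge0 //; exact: bd.
Qed.

Lemma sqn_subset K L v : uniq K -> uniq L -> {subset K <= L} -> sqn K v <= sqn L v.
Proof.
move=> uK uL KL; rewrite /sqn [X in _ <= X](bigID (mem K)) /= -[X in _ <= X + _]big_filter.
rewrite [X in _ <= X + _](perm_big K) /=.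
  by rewrite lerDl; apply: sumr_ge0 => u _; exact: sqr_ge0.
apply: uniq_perm => //; first exact: filter_uniq.
by move=> u; rewrite mem_filter; apply/andP/idP => [[]|uK'] //; split=> //; exact: KL.
Qed.

(** The form of [a^* a], evaluated at the conjugate of [v] and at [v], is the squared length of
    [a v]. This is the nontrivial half of the C*-identity. *)
Lemma bounded_by_sqrt a d : A a -> 0 <= d ->
  bounded_by (cp_mul P X (cp_star P X a) a) d -> bounded_by a (Num.sqrt d).
Proof.
move=> Aa d0 aad; apply/bounded_byP; first exact: sqrtr_ge0.
move=> w Xw L K v uL uK; rewrite sqr_sqrtr //.
(* Rows are added to [L] until all of [a v] is seen, as the product formula requires. *)
pose M := undup (L ++ hull a K).
have uM : uniq M by exact: undup_uniq.
apply: (@le_trans _ _ (sqn M (mxapp a w K v))).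
  by apply: sqn_subset => // u uL'; rewrite mem_undup mem_cat uL'.
have := aad w Xw K K (fun u => (v u)^*) v uK uK.
have -> : bform (cp_mul P X (cp_star P X a) a) w K K (fun u => (v u)^*) v =
    (sqn M (mxapp a w K v))%:C%C.
  rewrite /bform; under eq_bigr => u _.
    rewrite (mxapp_mul _ _ (cp_algS Aa) uM); last first.
      move=> t q tK; rewrite mem_undup mem_cat negb_or => /andP[_].
      exact: mat_hull.
    rewrite /mxapp mulr_sumr.
    over.
  rewrite exchange_big rmorph_sum; apply: eq_bigr => q _ /=.
  have cE : (mxapp a w K v q)^* = \sum_(u <- K) (v u)^* * (mat a w q u)^*.
    by rewrite rmorph_sum; apply: eq_bigr => u _; rewrite rmorphM mulrC.
  rewrite -conjc_mul_normc cE mulr_suml; apply: eq_bigr => u _ /=.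
  rewrite mulrA; congr (_ * _ * _).
  by rewrite /mat cp_starE // translateM invgM invgK mulgVK.
rewrite normc_real ger0_norm ?sqn_ge0 //.
have -> : sqn K (fun u => (v u)^*) = sqn K v.
  by apply: eq_bigr => u _; rewrite normc_conj.
lra.
Qed.

(** The matrix has at most one nonzero entry in each row and column. Each product is split into two
    squares, which [Y] charges to the row and [Z] to the column. *)
Lemma bounded_by_delta t f c : (forall w, normc (f w) <= c) ->
  bounded_by (delta t f) c.
Proof.
move=> fc w Xw L K x v uL uK.
have c0 : 0 <= c := le_trans (normc_ge0 _) (fc w).
pose Y r u := if u == (t^-1 * r)%g then c * normc (x r) ^+ 2 else 0.
pose Z r u := if r == (t * u)%g then c * normc (v u) ^+ 2 else 0.
apply: (@le_trans _ _ (\sum_(r <- L) \sum_(u <- K) (Y r u + Z r u))).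
  apply: (@le_trans _ _ (\sum_(r <- L) 2 * normc (x r * mxapp (delta t f) w K v r))).
    by rewrite -mulr_sumr ler_pM2l // normc_sum.
  apply: ler_sum => r _; rewrite Normc.normcM /mxapp.
  apply: (@le_trans _ _ (\sum_(u <- K) 2 * (normc (x r) * normc (mat (delta t f) w r u * v u)))).
    by rewrite -mulr_sumr ler_pM2l // -mulr_sumr ler_wpM2l ?normc_ge0 ?normc_sum.
  apply: ler_sum => u _; rewrite Normc.normcM /mat /delta /Y /Z.
  have -> : (u == t^-1 * r)%g = (r * u^-1 == t)%g.
    by apply/eqP/eqP => [->|<-]; rewrite invgM invgK ?mulVKg ?mulgVK.
  have -> : (r == t * u)%g = (r * u^-1 == t)%g by rewrite divg_eq.
  case: eqP => _; last by rewrite Normc.normc0 mul0r mulr0 mulr0 addr0.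
  have h := fc (translate r w); have f0 := normc_ge0 (f (translate r w)).
  have x0 := normc_ge0 (x r); have v0 := normc_ge0 (v u).
  apply: (@le_trans _ _ (c * (2 * (normc (x r) * normc (v u))))).
    have -> : 2 * (normc (x r) * (normc (f (translate r w)) * normc (v u))) =
      normc (f (translate r w)) * (2 * (normc (x r) * normc (v u))) by ring.
    by rewrite ler_wpM2r // !mulr_ge0.
  rewrite -mulrDr ler_wpM2l // -subr_ge0.
  have -> : normc (x r) ^+ 2 + normc (v u) ^+ 2 - 2 * (normc (x r) * normc (v u)) =
    (normc (x r) - normc (v u)) ^+ 2 by ring.
  exact: sqr_ge0.
under eq_bigr do rewrite big_split /=.
rewrite big_split /= mulrDr lerD //.
  rewrite mulr_sumr; apply: ler_sum => r _; apply: sum_indic_le => //.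
  by rewrite mulr_ge0 ?sqr_ge0.
rewrite exchange_big mulr_sumr; apply: ler_sum => u _; apply: sum_indic_le => //.
by rewrite mulr_ge0 ?sqr_ge0.
Qed.

(** [a t w] is the entry in row [t] and column 1 of the matrix of [a] over the point [t^-1 w]. *)
Lemma bounded_by_entry a c t w : A a -> 0 <= c -> bounded_by a c -> normc (a t w) <= c.
Proof.
move=> Aa c0 ac; have /cp_algP[_ _ a0] := Aa.
have [Dw|/a0 ->] := pselect (D t w); last by rewrite Normc.normc0.
have /cp_domP[Xw _] := (cp_domV t w).2 Dw.
have := ac _ Xw [:: t] [:: 1%g] (fun=> 1) (fun=> 1) isT isT.
rewrite /bform /mxapp /sqn !big_seq1 /mat invg1 mulg1 translateK mul1r mulr1.
by rewrite Normc.normc1 expr1n; lra.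
Qed.

Lemma cp_alg_sum a : A a -> a = \sum_(t <- cp_supp a) delta t (a t).
Proof.
move=> Aa; apply/funext => s; apply/funext => w.
rewrite fct_sumE fct_sumE /delta.
have [sa|sa] := boolP (s \in cp_supp a).
  rewrite (big_rem _ sa) /= eqxx big_seq big1 ?addr0 // => t.
  by rewrite mem_rem_uniq ?cp_supp_uniq // inE eq_sym => /andP[/negbTE ->].
rewrite (cp_supp0 Aa sa) big_seq big1 // => t ta.
by case: eqP => // st; rewrite st ta in sa.
Qed.

Lemma cp_alg_bounded a : A a -> exists2 c, 0 <= c & bounded_by a c.
Proof.
move=> Aa; have /cp_algP[_ ca a0] := Aa.
have /choice[m hm] : forall t, exists c : R, 0 <= c /\ forall w, normc (a t w) <= c.
  move=> t; have [c c0 cM] := ctsX_bounded (ca t); exists c; split=> // w.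
  have [Dw|/a0 ->] := pselect (D t w); last by rewrite Normc.normc0.
  by apply: cM; have /cp_domP[] := Dw.
exists (\sum_(t <- cp_supp a) m t); first by apply: sumr_ge0 => t _; have [] := hm t.
rewrite [X in bounded_by X _](cp_alg_sum Aa); apply: bounded_by_sum => t.
by apply: bounded_by_delta; have [] := hm t.
Qed.

(** The column of index 1 of [mat a w], that is, the fibre at [w] of [a] seen as a vector of the
    module l^2; its squared length is Phi(a^* a)(w). *)
Definition diag a w (u : G) : C := a u (translate u w).

Lemma diag_mat a w u : diag a w u = mat a w u 1%g.
Proof. by rewrite /mat invg1 mulg1. Qed.

Lemma cp_expect_star_mul a w K : A a -> uniq K ->
  (forall u, u \notin K -> a u = 0) ->
  cp_expect (cp_mul P X (cp_star P X a) a) w = (sqn K (diag a w))%:C%C.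
Proof.
move=> Aa uK K0; rewrite /cp_expect cp_mulE; last exact: cp_algS.
rewrite (reindex_fsbigT (fun u => u^-1)%g) /=; last first.
  by exists (fun u => u^-1)%g => u; rewrite invgK.
rewrite (fsum_seq uK) => [|u /K0 au].
  rewrite rmorph_sum; apply: eq_bigr => u _ /=.
  by rewrite cp_starE // invgK mulg1 conjc_mul_normc.
by rewrite cp_starE // invgK mulg1 au mulr0.
Qed.

Lemma sup_norm_ge (f : T -> C) w c : (forall z, X z -> normc (f z) <= c) -> X w ->
  normc (f w) <= sup_norm X f.
Proof.
move=> fc Xw; apply: ub_le_sup; last by exists w.
by exists c => _ [z Xz <-]; exact: fc.
Qed.

Lemma sup_norm_le (f : T -> C) c : 0 <= c -> (forall z, X z -> normc (f z) <= c) ->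
  sup_norm X f <= c.
Proof.
move=> c0 fc; rewrite /sup_norm.
have [[w Xw]|nX] := pselect (exists w, X w).
  by apply: ge_sup; [exists (normc (f w)), w|move=> _ [z Xz <-]; exact: fc].
rewrite (_ : image _ _ = set0) ?sup0 //.
by apply/seteqP; split=> // c' [z Xz _]; apply: nX; exists z.
Qed.

Lemma sup_norm_ge0 (f : T -> C) : 0 <= sup_norm X f.
Proof. by apply: sup_ge0 => c [w Xw <-]; exact: normc_ge0. Qed.

Lemma l2_norm_ge a w K : A a -> X w -> uniq K -> sqn K (diag a w) <= l2_norm P X a ^+ 2.
Proof.
move=> Aa Xw uK; rewrite /l2_norm sqr_sqrtr ?sup_norm_ge0 //.
pose L := undup (K ++ cp_supp a).
apply: (@le_trans _ _ (sqn L (diag a w))).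
  apply: sqn_subset => //; first exact: undup_uniq.
  by move=> u uK'; rewrite mem_undup mem_cat uK'.
have eE z : cp_expect (cp_mul P X (cp_star P X a) a) z = (sqn L (diag a z))%:C%C.
  apply: cp_expect_star_mul => //; first exact: undup_uniq.
  by move=> u; rewrite mem_undup mem_cat negb_or => /andP[_ /(cp_supp0 Aa)].
have [c c0 ac] := cp_alg_bounded Aa.
apply: le_trans (sup_norm_ge (c := \sum_(u <- L) c ^+ 2) _ Xw).
  by rewrite eE normc_real ger0_norm ?sqn_ge0.
move=> z Xz; rewrite eE normc_real ger0_norm ?sqn_ge0 //.
by apply: ler_sum => u _; rewrite lerXn2r ?nnegrE ?normc_ge0 //; exact: bounded_by_entry.
Qed.

Lemma l2_norm_le a c : A a -> 0 <= c ->
  (forall w K, X w -> uniq K -> sqn K (diag a w) <= c ^+ 2) -> l2_norm P X a <= c.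
Proof.
move=> Aa c0 ac; rewrite /l2_norm -[c]ger0_norm // -sqrtr_sqr ler_wsqrtr //.
apply: sup_norm_le; first exact: sqr_ge0.
move=> w Xw; rewrite (@cp_expect_star_mul _ _ (cp_supp a)) ?cp_supp_uniq //.
  by rewrite normc_real ger0_norm ?sqn_ge0 //; apply: ac => //; exact: cp_supp_uniq.
by move=> u; exact: cp_supp0.
Qed.

Lemma diag_mul a b w L r : A a -> uniq L -> (forall u, u \notin L -> b u = 0) ->
  diag (cp_mul P X a b) w r = mxapp a w L (diag b w) r.
Proof.
move=> Aa uL L0; rewrite diag_mat (mat_mul _ Aa uL) => [|q /L0 bq].
  by apply: eq_bigr => q _; rewrite diag_mat.
by rewrite -diag_mat /diag bq.
Qed.

Let unit_ball := A `&` [set x | l2_norm P X x <= 1].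

Lemma l2_norm_mul a b c : A a -> 0 <= c -> bounded_by a c -> unit_ball b ->
  l2_norm P X (cp_mul P X a b) <= c.
Proof.
move=> Aa c0 /(bounded_byP _ c0) ac [Ab /= b1].
apply: l2_norm_le => //; first exact: cp_algM.
move=> w K Xw uK; have uL := cp_supp_uniq b.
rewrite /sqn; under eq_bigr => r _.
  rewrite (diag_mul _ _ Aa uL); last by move=> u; exact: cp_supp0.
  over.
apply: le_trans (ac w Xw K _ _ uK uL) _.
rewrite -[X in _ <= X]mulr1 ler_wpM2l ?sqr_ge0 //.
apply: le_trans (l2_norm_ge Ab Xw uL) _.
by rewrite expr_le1 // sqrtr_ge0.
Qed.

Lemma unit_ball0 : unit_ball 0.
Proof.
split; first exact: cp_alg0.
apply: l2_norm_le => //; first exact: cp_alg0.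
move=> w K _ _; rewrite /sqn big1 // => u _.
by rewrite /diag Normc.normc0 expr0n.
Qed.

(** Together with [reduced_norm_bounded] this identifies the reduced norm as the least bound in the
    sense of [bounded_by], the form in which its C*-properties are proved. *)
Lemma reduced_norm_le a c : A a -> 0 <= c -> bounded_by a c -> norm a <= c.
Proof.
move=> Aa c0 ac; apply: ge_sup.
  by exists (l2_norm P X (cp_mul P X a 0)), 0 => //; exact: unit_ball0.
by move=> _ [x x1 <-]; exact: l2_norm_mul.
Qed.

Lemma reduced_norm_ub a b : A a -> unit_ball b ->
  l2_norm P X (cp_mul P X a b) <= norm a.
Proof.
move=> Aa b1; have [c c0 ac] := cp_alg_bounded Aa.
apply: ub_le_sup; last by exists b.
by exists c => _ [y y1 <-]; exact: l2_norm_mul.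
Qed.

Lemma reduced_norm_ge0 a : 0 <= norm a.
Proof. by apply: sup_ge0 => c [x Bx <-]; exact: sqrtr_ge0. Qed.

(** A nonzero entry in column [q] forces [q^-1] to lie in [w], and there the unit of [D_q] takes the
    value 1: truncating a vector by these units does not change its image. *)
Lemma mat_dom a w r q : A a -> X w -> mat a w r q != 0 -> D q (translate q w).
Proof.
move=> /cp_algP[_ _ a0] Xw nz.
have /cp_domP[Xr] : D (r * q^-1)%g (translate r w).
  by apply: contrapT => /a0 h; move/eqP: nz; apply.
rewrite /translate mulKg => wq; apply/cp_domP; split; first exact: X_translate.
by rewrite /translate mulVg; exact: X_one.
Qed.

(* A unit vector is realised by the element with coefficients proportional to
   the units of the algebras D_t, which lies in the unit ball at every point. *)
Lemma reduced_norm_bounded a : A a -> bounded_by a (norm a).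
Proof.
move=> Aa; apply/bounded_byP; first exact: reduced_norm_ge0.
move=> w Xw L K v uL uK; set s := sqn K v.
have [s0|sn] := eqVneq s 0.
  rewrite s0 mulr0 /sqn big1 // => r _.
  rewrite /mxapp big_seq big1 ?Normc.normc0 ?expr0n // => u uK'.
  suff -> : v u = 0 by rewrite mulr0.
  apply: Normc.eq0_normc; apply/eqP; rewrite -sqrf_eq0 eq_le sqr_ge0 andbT.
  rewrite -s0 /s /sqn (big_rem _ uK') /= lerDl.
  by apply: sumr_ge0 => ? _; exact: sqr_ge0.
have sp : 0 < s by rewrite lt_def sn sqn_ge0.
have qp : 0 < Num.sqrt s by rewrite sqrtr_gt0.
pose k : C := ((Num.sqrt s)^-1)%:C%C.
have nk : normc k ^+ 2 = s^-1.
  by rewrite normc_real ger0_norm ?invr_ge0 ?sqrtr_ge0 // exprVn sqr_sqrtr // ltW.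
pose x : G -> T -> C := fun t z => if t \in K then k * v t * (if z \in D t then 1 else 0) else 0.
have Ax : A x.
  apply/cp_algP; split.
  - apply: (@sub_finite_set _ _ [set` K]); last exact: finite_seq.
    move=> t /=; apply: contraNT => tK; apply/eqP/funext => z.
    by rewrite /x (negbTE tK).
  - move=> t; rewrite /x; case: (t \in K); last exact: ctsX0.
    by apply: ctsXZ => z Xz; exact: ctsX_dom1.
  - by move=> t z nz; rewrite /x; case: ifP => // _; rewrite memNset // mulr0.
have x1 : unit_ball x.
  split=> //=; apply: l2_norm_le => // z M Xz uM; rewrite expr1n.
  apply: (@le_trans _ _ (\sum_(t <- M) if t \in K then s^-1 * normc (v t) ^+ 2 else 0)).
    apply: ler_sum => t _; rewrite /diag /x; case: ifP => _.
      rewrite !Normc.normcM !exprMn nk -[X in _ <= X]mulr1 ler_wpM2l //.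
        by rewrite mulr_ge0 ?sqr_ge0 // invr_ge0 ltW.
      by case: ifP => _; rewrite ?Normc.normc1 ?Normc.normc0 ?expr1n ?expr0n.
    by rewrite Normc.normc0 expr0n.
  rewrite -big_mkcond /= -big_filter -mulr_sumr mulrC ler_pdivrMr // mul1r.
  apply: sqn_subset => //; first exact: filter_uniq.
  by move=> t; rewrite mem_filter => /andP[].
have := l2_norm_ge (cp_algM Aa Ax) Xw uL; rewrite -(ler_pM2r sp).
have -> : sqn L (diag (cp_mul P X a x) w) * s = sqn L (mxapp a w K v).
  rewrite /sqn mulr_suml; apply: eq_bigr => r _.
  rewrite (diag_mul _ _ Aa uK); last first.
    by move=> u uK'; apply/funext => z; rewrite /x (negbTE uK').
  have -> : mxapp a w K (diag x w) r = k * mxapp a w K v r.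
    rewrite /mxapp mulr_sumr big_seq [RHS]big_seq; apply: eq_bigr => u uK'.
    have [->|nz] := eqVneq (mat a w r u) 0; first by rewrite !mul0r mulr0.
    have Du := mat_dom Aa Xw nz.
    have -> : diag x w u = k * v u by rewrite /diag /x uK' (mem_set Du) mulr1.
    exact: mulrCA.
  by rewrite Normc.normcM exprMn nk mulrAC mulVf // mul1r.
move=> /le_trans; apply; rewrite ler_pM2r // lerXn2r ?nnegrE ?reduced_norm_ge0 ?sqrtr_ge0 //.
exact: reduced_norm_ub.
Qed.

Lemma reduced_normM a b : A a -> A b -> norm (cp_mul P X a b) <= norm a * norm b.
Proof.
move=> Aa Ab; apply: reduced_norm_le; first exact: cp_algM.
  by rewrite mulr_ge0 ?reduced_norm_ge0.
by apply: bounded_byM; rewrite ?reduced_norm_ge0 //; exact: reduced_norm_bounded.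
Qed.

Lemma cp_starK a : A a -> cp_star P X (cp_star P X a) = a.
Proof.
move=> Aa; apply/funext => t; apply/funext => w.
by rewrite cp_starE ?cp_starE ?invgK ?translateK ?conjCK //; exact: cp_algS.
Qed.

Lemma reduced_norm_star a : A a -> norm (cp_star P X a) = norm a.
Proof.
have le b : A b -> norm (cp_star P X b) <= norm b.
  move=> Ab; apply: reduced_norm_le; [exact: cp_algS|exact: reduced_norm_ge0|].
  by apply: bounded_by_star => //; exact: reduced_norm_bounded.
move=> Aa; apply/eqP; rewrite eq_le le //=.
by rewrite -[X in _ (norm X) _](cp_starK Aa) le //; exact: cp_algS.
Qed.

Lemma reduced_norm_cstar a : A a ->
  norm (cp_mul P X (cp_star P X a) a) = norm a ^+ 2.
Proof.
move=> Aa; have As := cp_algS Aa; have Aaa := cp_algM As Aa.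
apply/eqP; rewrite eq_le; apply/andP; split.
  by apply: le_trans (reduced_normM As Aa) _; rewrite reduced_norm_star // expr2.
have n0 := reduced_norm_ge0 (cp_mul P X (cp_star P X a) a).
rewrite -[X in _ <= X](sqr_sqrtr n0) lerXn2r ?nnegrE ?reduced_norm_ge0 ?sqrtr_ge0 //.
apply: reduced_norm_le; [exact: Aa|exact: sqrtr_ge0|].
by apply: bounded_by_sqrt => //; exact: reduced_norm_bounded.
Qed.

Lemma reduced_norm_scale_le z a : A a -> norm (cp_scale z a) <= normc z * norm a.
Proof.
move=> Aa; apply: reduced_norm_le; first exact: cp_algZ.
  by rewrite mulr_ge0 ?normc_ge0 ?reduced_norm_ge0.
by apply: bounded_byZ; exact: reduced_norm_bounded.
Qed.

Lemma reduced_norm_scale z a : A a -> norm (cp_scale z a) = normc z * norm a.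
Proof.
move=> Aa; apply/eqP; rewrite eq_le reduced_norm_scale_le //=.
have [->|z0] := eqVneq z 0; first by rewrite Normc.normc0 mul0r reduced_norm_ge0.
have nz : 0 < normc z.
  by rewrite lt_def normc_ge0 andbT; apply: contraNneq z0 => /Normc.eq0_normc ->.
have := reduced_norm_scale_le z^-1 (cp_algZ z Aa).
have -> : cp_scale z^-1 (cp_scale z a) = a.
  by apply/funext => t; apply/funext => w; rewrite /cp_scale mulKf.
by rewrite Normc.normcV (ler_pdivlMl _ _ nz).
Qed.

Lemma reduced_norm_seminorm : cstar_seminorm P X norm.
Proof.
split.
- by move=> a _; exact: reduced_norm_ge0.
- by move=> z a; exact: reduced_norm_scale.
- move=> a b Aa Ab; apply: reduced_norm_le; first exact: cp_algD.
    by rewrite addr_ge0 ?reduced_norm_ge0.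
  by apply: bounded_byD; exact: reduced_norm_bounded.
- by move=> a b; exact: reduced_normM.
- by move=> a Aa; rewrite reduced_norm_star // reduced_norm_cstar.
Qed.

End RegularRepresentation.

(** * C*-seminorms on the algebra of finite sums *)

Section Seminorms.
Implicit Types (a b : G -> T -> C) (w : T) (K : seq G).

Lemma cp_star_mul a b : A a -> A b -> star (mul a b) = mul (star b) (star a).
Proof.
move=> Aa Ab; apply/funext => t; apply/funext => w.
have Asa := cp_algS Aa; have Asb := cp_algS Ab.
rewrite cp_starE; last exact: cp_algM.
rewrite (cp_mulE _ _ _ Asb) (reindex_fsbigT (fun s => t * s)%g) /=; last first.
  by exists (fun s => t^-1 * s)%g => s; rewrite ?mulKg ?mulVKg.
rewrite (cp_mulE _ _ _ Aa) !(fsum_seq (cp_supp_uniq a)).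
- rewrite rmorph_sum; apply: eq_bigr => s _ /=; rewrite rmorphM /=.
  rewrite !cp_starE // !translateM.
  have -> : ((t * s)^-1 * t)^-1%g = s by rewrite invgM invgK mulKg.
  by rewrite invgM mulVKg mulrC.
- move=> s /(cp_supp0 Aa) as0; rewrite [star a _ _]cp_starE //.
  by rewrite invgM invgK mulKg as0 conjC0 mulr0.
- by move=> s /(cp_supp0 Aa) ->; rewrite mul0r.
Qed.

Definition sqpow z k := iter k (fun a => mul a a) z.

Lemma sqpow_alg z k : A z -> A (sqpow z k).
Proof. by move=> Az; elim: k => //= k Ak; exact: cp_algM. Qed.

Lemma sqpow_star z k : A z -> star z = z -> star (sqpow z k) = sqpow z k.
Proof.
move=> Az zz; elim: k => //= k IH.
by rewrite cp_star_mul ?IH //; exact: sqpow_alg.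
Qed.

Lemma seminorm_sqpow (p : (G -> T -> C) -> R) z k : cstar_seminorm P X p ->
  A z -> star z = z -> p (sqpow z k) = p z ^+ (2 ^ k).
Proof.
move=> [_ _ _ _ pC] Az zz; elim: k => [|k IH]; first by rewrite expr1.
have Ak := sqpow_alg k Az; have [_ h] := pC _ Ak.
rewrite sqpow_star // in h; rewrite [sqpow z k.+1]/= h IH expnS mulnC exprM.
by rewrite expr2.
Qed.

Section OneSeminorm.
Variable p : (G -> T -> C) -> R.
Hypothesis pS : cstar_seminorm P X p.

Lemma seminorm_ge0 a : A a -> 0 <= p a.
Proof. by have [h _ _ _ _] := pS; exact: h. Qed.

Lemma seminormZ c a : A a -> p (cp_scale c a) = normc c * p a.
Proof. by have [_ h _ _ _] := pS; exact: h. Qed.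

Lemma seminormD a b : A a -> A b -> p (a + b) <= p a + p b.
Proof. by have [_ _ h _ _] := pS; exact: h. Qed.

Lemma seminorm_star a : A a -> p (star a) = p a.
Proof. by have [_ _ _ _ h] := pS; move=> /h[]. Qed.

Lemma seminorm_cstar a : A a -> p (mul (star a) a) = p a ^+ 2.
Proof. by have [_ _ _ _ h] := pS; move=> /h[]. Qed.

Lemma seminorm0 : p 0 = 0.
Proof.
have {1}-> : (0 : G -> T -> C) = cp_scale 0 0.
  by apply/funext => t; apply/funext => w; rewrite /cp_scale mul0r.
by rewrite seminormZ ?Normc.normc0 ?mul0r //; exact: cp_alg0.
Qed.

Lemma seminorm_sum (I : Type) (r : seq I) (F : I -> G -> T -> C) :
  (forall i, A (F i)) -> A (\sum_(i <- r) F i) /\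
  p (\sum_(i <- r) F i) <= \sum_(i <- r) p (F i).
Proof.
move=> AF; elim: r => [|i r [Ar IH]].
  by rewrite !big_nil seminorm0; split=> //; exact: cp_alg0.
rewrite !big_cons; split; first exact: cp_algD.
by apply: le_trans (seminormD (AF i) Ar) _; rewrite lerD2l.
Qed.

Definition real_delta (g : T -> R) := delta (1%g : G) (fun w => (g w)%:C%C : C).

Lemma mul_delta1 (f g : T -> C) : A (delta 1%g f) ->
  mul (delta 1%g f) (delta 1%g g) = delta 1%g (fun w => f w * g w).
Proof.
move=> Af; apply/funext => r; apply/funext => w.
rewrite cp_mulE // (fsum_seq (K := [:: 1%g])) // => [|s].
  by rewrite big_seq1 /delta eqxx invg1 mul1g translate1; case: eqP; rewrite ?mulr0.
by rewrite inE /delta => /negbTE ->; rewrite mul0r.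
Qed.

Lemma star_delta1 (f : T -> C) : A (delta 1%g f) ->
  star (delta 1%g f) = delta 1%g (fun w => (f w)^*).
Proof.
move=> Af; apply/funext => r; apply/funext => w.
rewrite cp_starE // /delta invg_eq1; case: eqP => [->|_]; last by rewrite conjC0.
by rewrite invg1 translate1.
Qed.

(* [h] is the real part of the unitary h + i sqrt(1 - h^2) of C(X). *)
Lemma seminorm_real_le1 (h : T -> R) : A (real_delta h) ->
  (forall w, 0 <= h w <= 1) -> p (real_delta h) <= 1.
Proof.
move=> Ah h01; have /cp_algP[_ ch h0] := Ah.
(* [e] is the unit of C(X), extended by zero because coefficients must vanish off [X]. *)
pose e w : C := if w \in D 1%g then 1 else 0.
pose k w := Num.sqrt (1 - h w ^+ 2).
pose u w : C := e w * (Complex (h w) (k w)).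
have ce : ctsX e by move=> w Xw; exact: ctsX_dom1.
have hE : (fun w => normc (real_delta h 1%g w)) = h.
  apply/funext => w; rewrite /real_delta /delta eqxx normc_real ger0_norm //.
  by have /andP[] := h01 w.
have ck : ctsX (fun w => (k w)%:C%C : C).
  move=> w Xw; apply: cvg_real_complex.
  apply: (@continuous_cvg _ _ _ _ _ (fun w => 1 - h w ^+ 2) Num.sqrt).
    exact: sqrt_continuous.
  apply: cvgB; first exact: cvg_cst.
  have hc : h z @[z --> within X (nbhs w)] --> h w.
    have hw : normc (real_delta h 1%g w) = h w by rewrite -[in RHS]hE.
    by have := cvg_normc (ch 1%g w Xw); rewrite hE hw; apply.
  exact: (cvgM hc hc).
have cu : ctsX u.
  have -> : u = fun w => e w * (real_delta h 1%g w + 'i%C * (k w)%:C%C).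
    apply/funext => w; rewrite /u /real_delta /delta eqxx; congr (_ * _).
    by rewrite [LHS]complexE.
  apply: ctsXM; first exact: ce.
  by apply: ctsXD; [exact: ch|exact: ctsXZ].
have Ae : A (delta 1%g e).
  by apply: cp_alg_delta; [exact: ce|move=> w nw; rewrite /e memNset].
have Au : A (delta 1%g u).
  by apply: cp_alg_delta; [exact: cu|move=> w nw; rewrite /u /e memNset // mul0r].
have eJ w : (e w)^* = e w by rewrite /e; case: ifP; rewrite ?conjC1 ?conjC0.
have ee w : e w * e w = e w by rewrite /e; case: ifP; rewrite ?mulr1 ?mulr0.
(* The unit is a projection, so its seminorm equals its own square; it may be 0, hence only an
   inequality. *)
have p1 : p (delta 1%g e) <= 1.
  have := seminorm_cstar Ae; rewrite star_delta1 //.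
  have -> : (fun w => (e w)^*) = e by apply/funext.
  rewrite mul_delta1 //; have -> : (fun w => e w * e w) = e by apply/funext.
  have := seminorm_ge0 Ae; nra.
have pu : p (delta 1%g u) <= 1.
  have := seminorm_cstar Au; rewrite star_delta1 // mul_delta1; last first.
    by rewrite -star_delta1 //; exact: cp_algS.
  have -> : (fun w => (u w)^* * u w) = e.
    apply/funext => w; rewrite conjc_mul_normc /u Normc.normcM.
    rewrite /= sqr_sqrtr; last first.
      by have := h01 w; nra.
    rewrite addrC subrK sqrtr1 mulr1 /e; case: ifP => _.
      by rewrite Normc.normc1 expr1n.
    by rewrite Normc.normc0 expr0n.
  have := seminorm_ge0 Au; nra.
have hu : delta 1%g u + star (delta 1%g u) = cp_scale 2 (real_delta h).
  rewrite star_delta1 //; apply/funext => t; apply/funext => w.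
  rewrite /cp_scale /real_delta !fctE /delta; case: eqP => [_|_]; last first.
    by rewrite addr0 mulr0.
  rewrite /u rmorphM /= eJ -mulrDr.
  rewrite [Complex _ _ + _](_ : _ = 2 * (h w)%:C%C); last first.
    by apply/eqP; rewrite eq_complex /=; apply/andP; split; apply/eqP; ring.
  rewrite /e; case: ifP => [_|wD]; first by rewrite mul1r.
  have /(_ 1%g w) := h0; rewrite /real_delta /delta eqxx => -> //.
    by rewrite mulr0 mul0r.
  by move=> /mem_set; rewrite wD.
have := seminormD Au (cp_algS Au); rewrite hu seminormZ // seminorm_star //.
have -> : normc (2 : C) = 2.
  by rewrite -[2 : C](rmorph_nat (real_complex R)) normc_real normr_nat.
lra.
Qed.

Lemma star_mul_delta t (f : T -> C) : A (delta t f) ->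
  mul (star (delta t f)) (delta t f) =
  real_delta (fun w => normc (f (translate t w)) ^+ 2).
Proof.
move=> Af; have As := cp_algS Af; apply/funext => r; apply/funext => w.
rewrite cp_mulE // (fsum_seq (K := [:: t^-1%g])) // => [|s].
  rewrite big_seq1 cp_starE // invgK /real_delta /delta eqxx.
  have -> : (t * r == t)%g = (r == 1)%g.
    by apply/eqP/eqP => [|->]; rewrite ?mulg1 // -{2}[t]mulg1 => /mulgI.
  by case: eqP => _; [exact: conjc_mul_normc|rewrite mulr0].
rewrite inE cp_starE // /delta => st; case: eqP => [ts|_].
  by rewrite -ts invgK eqxx in st.
by rewrite conjC0 mul0r.
Qed.

(** The product of the adjoint with the element lives at the identity, so the C*-identity reduces
    the claim to a real function with values in [0, 1]. *)
Lemma seminorm_delta_le1 t (f : T -> C) : A (delta t f) ->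
  (forall w, normc (f w) <= 1) -> p (delta t f) <= 1.
Proof.
move=> Af f1; have := seminorm_cstar Af; rewrite star_mul_delta // => pE.
have : p (delta t f) ^+ 2 <= 1.
  rewrite -pE; apply: seminorm_real_le1.
    by rewrite -star_mul_delta //; apply: cp_algM => //; exact: cp_algS.
  by move=> w; rewrite sqr_ge0 expr_le1 ?normc_ge0 //; exact: f1.
by rewrite expr_le1 //; exact: seminorm_ge0.
Qed.

Lemma delta_entry_alg a t : A a -> A (delta t (a t)).
Proof.
by move=> /cp_algP[_ ca a0]; apply: cp_alg_delta; [exact: ca|move=> w; exact: a0].
Qed.

Lemma seminorm_entry a t : A a -> p (delta t (a t)) <= norm a.
Proof.
move=> Aa; have Ad := delta_entry_alg t Aa.
have n0 : 0 <= norm a by exact: reduced_norm_ge0.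
have entry w : normc (a t w) <= norm a.
  by apply: bounded_by_entry => //; exact: reduced_norm_bounded.
have [n00|nn] := eqVneq (norm a) 0.
  suff -> : delta t (a t) = 0 by rewrite seminorm0.
  apply/funext => s; apply/funext => w; rewrite /delta; case: eqP => // _.
  by apply: Normc.eq0_normc; apply/eqP; rewrite eq_le normc_ge0 andbT -n00.
have np : 0 < norm a by rewrite lt_def nn.
pose c : C := (norm a)%:C%C.
have cn : normc c = norm a by rewrite normc_real ger0_norm.
have c0 : c != 0 by apply: contra_neq nn => c0; rewrite -cn c0 Normc.normc0.
have Ac : A (delta t (fun w => c^-1 * a t w)).
  have /cp_algP[_ ca a0] := Aa; apply: cp_alg_delta; first exact: ctsXZ.
  by move=> w nw; rewrite a0 // mulr0.
have -> : delta t (a t) = cp_scale c (delta t (fun w => c^-1 * a t w)).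
  apply/funext => s; apply/funext => w; rewrite /cp_scale /delta.
  by case: eqP => _; rewrite ?mulVKf // mulr0.
rewrite seminormZ // cn -[X in _ <= X]mulr1 ler_wpM2l //.
apply: seminorm_delta_le1 => // w.
by rewrite Normc.normcM Normc.normcV cn ler_pdivrMl // mulr1.
Qed.

Lemma seminorm_card a K : A a -> uniq K -> (forall t, t \notin K -> a t = 0) ->
  p a <= (size K)%:R * norm a.
Proof.
move=> Aa uK K0; rewrite {1}(cp_alg_sum Aa).
have [_ h] := seminorm_sum (cp_supp a) (fun t => delta_entry_alg t Aa).
apply: le_trans h _.
apply: (@le_trans _ _ (\sum_(t <- cp_supp a) norm a)).
  by apply: ler_sum => t _; exact: seminorm_entry.
rewrite big_const_seq count_predT iter_addr addr0 -[X in X <= _]mulr_natl.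
rewrite ler_wpM2r ?reduced_norm_ge0 // ler_nat; apply: uniq_leq_size.
  exact: cp_supp_uniq.
move=> t; rewrite mem_cp_supp //; apply: contraNT => /K0 ->; exact: eqxx.
Qed.

Lemma seminorm_le_of_powers z c d : A z -> star z = z ->
  (forall k, p (sqpow z k) <= c * (2 ^ k).+1%:R ^+ d * norm (sqpow z k)) ->
  p z <= norm z.
Proof.
move=> Az zz h; apply: (@poly_power_bound _ _ _ c d).
- exact: seminorm_ge0.
- exact: reduced_norm_ge0.
move=> k; have := h k; rewrite (seminorm_sqpow k pS Az zz).
by rewrite (seminorm_sqpow k reduced_norm_seminorm Az zz).
Qed.

End OneSeminorm.

(** * Grading by a map to a commutative group *)

Section Grading.
Variables (V : groupType) (Q : set V) (phi : G -> V).
Hypothesis VC : forall x y : V, commute x y.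
Hypotheses (Qsub : submonoid Q) (Psub : submonoid P).
Hypothesis join_uniq :
  forall x y z z', is_join P x y z -> is_join P x y z' -> z = z'.
Hypothesis phiM : forall x y, phi (x * y)%g = (phi x * phi y)%g.
Hypothesis phi_pos : forall x, P x -> Q (phi x).
Hypothesis phi_finite : forall q, finite_set (P `&` [set x | pos_le Q (phi x) q]).
Hypothesis phi_join : forall x y z, P x -> P y -> is_join P x y z ->
  is_join Q (phi x) (phi y) (phi z).

Definition grade (g : V) a : G -> T -> C := fun t => if phi t == g then a t else 0.

Lemma phi1 : phi 1%g = 1%g.
Proof. by apply: (mulgI (phi 1%g)); rewrite -phiM !mulg1. Qed.

Lemma phiV x : phi x^-1%g = (phi x)^-1%g.
Proof. by apply: (mulgI (phi x)); rewrite -phiM !mulgV phi1. Qed.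

Lemma grade_alg g a : A a -> A (grade g a).
Proof.
move=> /cp_algP[fa ca a0]; apply/cp_algP; split.
- apply: sub_finite_set fa => t /=; apply: contraNneq => at0.
  by rewrite /grade at0 if_same.
- move=> t; rewrite /grade; case: eqP => _; [exact: ca|exact: ctsX0].
- by move=> t w nw; rewrite /grade; case: eqP => // _; exact: a0.
Qed.

Lemma sum_blocks (y : V) (B : seq V) (K : seq G) (F : G -> R) : uniq B ->
  (forall u, 0 <= F u) ->
  \sum_(b <- B) \sum_(u <- K | phi u == (y * b)%g) F u <= \sum_(u <- K) F u.
Proof.
move=> uB F0; under eq_bigr do rewrite big_mkcond /=.
rewrite exchange_big; apply: ler_sum => u _ /=.
apply: le_trans (sum_indic_le (y^-1 * phi u)%g uB (F0 u)).
rewrite le_eqVlt; apply/orP; left; apply/eqP; apply: eq_bigr => b _.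
congr (if _ then _ else _).
by apply/eqP/eqP => [->|->]; rewrite ?mulKg ?mulVKg.
Qed.

(* The component of degree [g] is block diagonal for the decomposition of the
   regular representation into the fibres of [phi]. *)
Lemma bounded_by_grade g a c : 0 <= c -> bounded_by a c -> bounded_by (grade g a) c.
Proof.
move=> c0 ac w Xw L K x v uL uK.
pose B := undup [seq phi u | u <- K].
have uB : uniq B by exact: undup_uniq.
have -> : bform (grade g a) w L K x v = \sum_(b <- B)
    bform a w [seq r <- L | phi r == (g * b)%g] [seq u <- K | phi u == b] x v.
  rewrite /bform; under [RHS]eq_bigr do rewrite big_filter big_mkcond.
  rewrite exchange_big; apply: eq_bigr => r _ /=.
  rewrite /mxapp; under [RHS]eq_bigr do rewrite big_filter big_mkcond.
  rewrite mulr_sumr.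
  transitivity (\sum_(b <- B) \sum_(u <- K) (if (phi r == g * b)%g && (phi u == b)
      then x r * (mat a w r u * v u) else 0)); last first.
    apply: eq_bigr => b _; case: eqP => _ /=; last by rewrite big1.
    rewrite mulr_sumr; apply: eq_bigr => u _.
    by case: eqP => _ //; rewrite mulr0.
  rewrite exchange_big /= big_seq [RHS]big_seq; apply: eq_bigr => u uK'.
  have uB' : phi u \in B by rewrite mem_undup map_f.
  rewrite (big_rem _ uB') /= eqxx andbT big_seq big1 ?addr0; last first.
    move=> b; rewrite mem_rem_uniq // inE => /andP[bu _].
    by rewrite [phi u == b]eq_sym (negbTE bu) andbF.
  rewrite /mat /grade phiM phiV.
  have -> : (phi r / phi u == g)%g = (phi r == g * phi u)%g by rewrite divg_eq.
  by case: eqP => _ //; rewrite mul0r mulr0.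
apply: (@le_trans _ _ (\sum_(b <- B) c * (
    sqn [seq r <- L | phi r == (g * b)%g] x + sqn [seq u <- K | phi u == b] v))).
  apply: le_trans (_ : 2 * (\sum_(b <- B) normc (bform a w
      [seq r <- L | phi r == (g * b)%g] [seq u <- K | phi u == b] x v)) <= _).
    by rewrite ler_pM2l // normc_sum.
  rewrite mulr_sumr; apply: ler_sum => b _.
  by apply: ac => //; exact: filter_uniq.
rewrite -mulr_sumr ler_wpM2l // big_split /= lerD //.
  rewrite /sqn; under eq_bigr do rewrite big_filter.
  by apply: sum_blocks => // u; exact: sqr_ge0.
apply: le_trans (sum_blocks 1%g K uB (fun u => sqr_ge0 (normc (v u)))).
rewrite le_eqVlt; apply/orP; left; apply/eqP; apply: eq_bigr => b _.
by rewrite /sqn big_filter; apply: eq_bigl => u; rewrite mul1g.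
Qed.

Lemma reduced_norm_grade g a : A a -> norm (grade g a) <= norm a.
Proof.
move=> Aa; apply: reduced_norm_le; [exact: grade_alg|exact: reduced_norm_ge0|].
by apply: bounded_by_grade; [exact: reduced_norm_ge0|exact: reduced_norm_bounded].
Qed.

Lemma grade_sum a (B : seq V) : A a -> uniq B ->
  (forall t, a t != 0 -> phi t \in B) -> a = \sum_(b <- B) grade b a.
Proof.
move=> Aa uB aB; apply/funext => t; rewrite fct_sumE /grade.
have [->|at0] := eqVneq (a t) 0; first by rewrite big1 // => b _; case: eqP.
rewrite (big_rem _ (aB _ at0)) /= eqxx big_seq big1 ?addr0 // => b.
by rewrite mem_rem_uniq // inE eq_sym => /andP[/negbTE ->].
Qed.

(* [w h] is required so that two such elements have a join at the intermediate
   point of a product: this keeps [small n] stable under multiplication. *)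
Definition small (n : V) a : Prop := forall t w, a t w != 0 ->
  phi t = 1%g /\ exists h, [/\ w h, P h, P (t^-1 * h)%g & pos_le Q (phi h) n].

Lemma dom_of_neq0 a t w : A a -> a t w != 0 -> X w /\ w t.
Proof.
move=> /cp_algP[_ _ a0] nz; apply/(cp_domP t w); apply: contrapT => /a0 h.
by move/eqP: nz; apply.
Qed.

Lemma pos_le_Q_trans (x y z : V) : pos_le Q x y -> pos_le Q y z -> pos_le Q x z.
Proof.
have [_ QM] := Qsub; rewrite /pos_le => xy yz; have := QM _ _ xy yz.
by rewrite mulgA mulgK.
Qed.

(** Let [h] and [k] be the witnesses of the two factors. Over the point [s^-1 w], directedness gives
    a join [j] of the positive elements [s^-1 h] and [k], and [s j] is the new witness. Its degree
    is a join of two degrees below [n], so the same [n] serves again. *)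
Lemma small_mul n a b : A a -> A b -> small n a -> small n b -> small n (mul a b).
Proof.
move=> Aa Ab an bn r w /(cp_mul_neq0 Aa)[s [/[dup] nza /an[ps [h [wh Ph Psh hn]]]]].
move=> /[dup] nzb /bn[pt [k [wk Pk Ptk kn]]].
split; first by rewrite -[r](mulVKg s) phiM ps pt mulg1.
have [Xw ws] := dom_of_neq0 Aa nza.
have Xsw : X (translate s^-1%g w) by have [] := dom_of_neq0 Ab nzb.
have [_ _ dir] := XP Xsw.
have wsh : translate s^-1%g w (s^-1 * h)%g by rewrite /translate invgK mulVKg.
have [j jJ wj] := dir _ _ wsh wk; have [shj kj _] := jJ.
have [_ PM] := Psub.
have Pj : P j by have := PM _ _ Pk kj; rewrite mulVKg.
exists (s * j)%g; split.
- by move: wj; rewrite /translate invgK.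
- by have := PM _ _ Ph shj; rewrite invgM invgK -!mulgA mulVKg.
- by have := PM _ _ Ptk kj; rewrite -!mulgA mulVKg invgM invgK -!mulgA.
rewrite phiM ps mul1g; have [_ _ lub] := phi_join Psh Pk jJ.
by apply: lub => //; rewrite phiM phiV ps invg1 mul1g.
Qed.

(** [t = h (t^-1 h)^-1] is a quotient of two positive elements of the same degree, at most [n];
    [phi_finite] leaves finitely many of them. *)
Lemma small_support n : exists K, uniq K /\
  forall a, small n a -> forall t, t \notin K -> a t = 0.
Proof.
have fin := phi_finite n.
pose F := (fun p : G * G => (p.1 / p.2)%g) @`
  ((P `&` [set x | pos_le Q (phi x) n]) `*` (P `&` [set x | pos_le Q (phi x) n])).
have finF : finite_set F by apply: finite_image; exact: finite_setX.
exists (fset_set F); split; first exact: fset_uniq.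
move=> a an t tF; apply/funext => w; apply/eqP/negPn/negP => /an[pt [h [wh Ph Pth hn]]].
move: tF; rewrite in_fset_set // => /negP; apply; apply: mem_set.
exists (h, t^-1 * h)%g; last by rewrite /= invgM invgK mulVKg.
by split=> //; split=> //=; rewrite phiM phiV pt invg1 mul1g.
Qed.

(** A point with a nonzero coefficient at [t] contains [t] and 1, hence their join, which by
    uniqueness is one and the same [h] for all such points. The bound [n] is the product of the
    degrees of these joins over the support. *)
Lemma exists_small a : A a -> (forall t, a t != 0 -> phi t = 1%g) ->
  exists n, small n a.
Proof.
move=> Aa a1.
suff [n [_ h]] : exists n, Q n /\ forall t, t \in cp_supp a -> forall w, a t w != 0 ->
    exists h, [/\ w h, P h, P (t^-1 * h)%g & pos_le Q (phi h) n].
  exists n => t w nz; have at0 : a t != 0 by apply: contraNneq nz => ->.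
  by split; [exact: a1|apply: h => //; rewrite mem_cp_supp].
have [Q1 QM] := Qsub.
elim: (cp_supp a) => [|t l [n [Qn IH]]]; first by exists 1%g.
have [[w0 nz0]|none] := pselect (exists w, a t w != 0); last first.
  exists n; split=> // s; rewrite inE => /orP[/eqP -> w nz|/IH //].
  by exfalso; apply: none; exists w.
have joint w : a t w != 0 -> exists2 z, is_join P t 1%g z & w z.
  move=> nz; have [Xw wt] := dom_of_neq0 Aa nz.
  by have [w1 _ dir] := XP Xw; exact: dir.
have [z zJ _] := joint w0 nz0; have [tz z1 _] := zJ.
have Pz : P z by move: z1; rewrite /pos_le invg1 mul1g.
exists (n * phi z)%g; split; first by apply: QM => //; exact: phi_pos.
move=> s; rewrite inE => /orP[/eqP -> w nz|/IH h w nz].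
  have [z' /(join_uniq zJ) <- wz] := joint w nz.
  by exists z; split=> //; rewrite /pos_le (VC n) mulKg.
have [k [wk Pk Psk kn]] := h w nz; exists k; split=> //.
apply: (pos_le_Q_trans kn); rewrite /pos_le mulKg; exact: phi_pos.
Qed.

Lemma small_sqpow n z k : A z -> small n z -> small n (sqpow z k).
Proof.
by move=> Az zn; elim: k => //= k IH; apply: small_mul => //; exact: sqpow_alg.
Qed.

Lemma star_neq0 a t : A a -> star a t != 0 -> a t^-1%g != 0.
Proof.
move=> Aa; apply: contraNneq => at0; apply/eqP/funext => w.
by rewrite cp_starE // at0 conjC0.
Qed.

Lemma mul_neq0 a b r : A a -> mul a b r != 0 ->
  exists s, a s != 0 /\ b (s^-1 * r)%g != 0.
Proof.
move=> Aa nz; have [w nzw] : exists w, mul a b r w != 0.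
  apply: contrapT => none; move/eqP: nz; apply; apply/funext => w.
  by apply/eqP/negPn/negP => h; apply: none; exists w.
have [s [as0 bs0]] := cp_mul_neq0 Aa nzw; exists s.
by split; [apply: contraNneq as0 => ->|apply: contraNneq bs0 => ->].
Qed.

(** Monomials in the elements of [B] with exponents at most [m]. By commutativity they include all
    products of [m] elements of [B], while their number is only polynomial in [m]. *)
Fixpoint box (B : seq V) m : seq V :=
  if B is b :: B' then [seq (b ^+ i * x)%g | i <- iota 0 m.+1, x <- box B' m]
  else [:: 1%g].

Lemma size_box B m : size (box B m) = (m.+1 ^ size B)%N.
Proof. by elim: B => // y B IH; rewrite [LHS]size_allpairs size_iota IH expnS. Qed.

Lemma boxP (b : V) B m y : reflect (exists i x, [/\ (i <= m)%N, x \in box B m & y = b ^+ i * x]%g)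
  (y \in box (b :: B) m).
Proof.
apply: (iffP allpairsP) => [[[i x] [im xB ->]]|[i [x [im xB ->]]]].
  by exists i, x; split=> //; move: im; rewrite mem_iota.
by exists (i, x); split=> //; rewrite mem_iota.
Qed.

Lemma box1 B m : 1%g \in box B m.
Proof.
by elim: B => [|b B IH]; rewrite ?inE //; apply/boxP; exists 0%N, 1%g; rewrite mulg1.
Qed.

Lemma mem_box B x m : (0 < m)%N -> x \in B -> x \in box B m.
Proof.
move=> m0; elim: B => // b B IH; rewrite inE => /orP[/eqP ->|/IH xB]; apply/boxP.
  by exists 1%N, 1%g; rewrite mulg1 box1.
by exists 0%N, x; rewrite mul1g.
Qed.

Lemma box_mul B x y m n : x \in box B m -> y \in box B n -> (x * y)%g \in box B (m + n).
Proof.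
elim: B x y => [|b B IH] x y; first by rewrite !inE => /eqP -> /eqP ->; rewrite mulg1.
move=> /boxP[i [x' [im xB ->]]] /boxP[j [y' [jn yB ->]]]; apply/boxP.
exists (i + j)%N, (x' * y')%g; split; [exact: leq_add|exact: IH|].
by rewrite expgnDr -!mulgA; congr (_ * _)%g; rewrite !mulgA; congr (_ * _)%g; exact: VC.
Qed.

Section OneSeminorm.
Variable p : (G -> T -> C) -> R.
Hypothesis pS : cstar_seminorm P X p.

Lemma seminorm_degree1 y : A y -> star y = y -> (forall t, y t != 0 -> phi t = 1%g) ->
  p y <= norm y.
Proof.
move=> Ay yy /(exists_small Ay)[n yn]; have [K [uK K0]] := small_support n.
apply: (seminorm_le_of_powers pS (c := (size K)%:R) (d := 0)) => // k; rewrite expr0 mulr1.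
apply: (seminorm_card pS) => //; first exact: sqpow_alg.
by apply: K0; exact: small_sqpow.
Qed.

Lemma seminorm_grade g a : A a -> p (grade g a) <= norm a.
Proof.
move=> Aa; apply: le_trans (reduced_norm_grade g Aa).
have Ag := grade_alg g Aa; have As := cp_algS Ag.
set x := grade g a in Ag As *.
have xg t : x t != 0 -> phi t = g.
  by rewrite /x /grade; case: (phi t =P g) => // _; rewrite eqxx.
have : p (mul (star x) x) <= norm (mul (star x) x).
  apply: seminorm_degree1; first exact: cp_algM.
    by rewrite cp_star_mul // cp_starK.
  move=> r /(mul_neq0 As)[s [/(star_neq0 Ag)/xg sg /xg rg]].
  by rewrite -[r](mulVKg s) phiM rg -sg phiV mulgV.
rewrite (seminorm_cstar pS Ag) (reduced_norm_cstar Ag).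
by rewrite ler_pXn2r ?nnegrE ?reduced_norm_ge0 ?(seminorm_ge0 pS).
Qed.

Lemma seminorm_degrees a (B : seq V) : A a -> uniq B ->
  (forall t, a t != 0 -> phi t \in B) -> p a <= (size B)%:R * norm a.
Proof.
move=> Aa uB aB; rewrite {1}(grade_sum Aa uB aB).
have [_ h] := seminorm_sum pS B (fun y => grade_alg y Aa); apply: le_trans h _.
apply: (@le_trans _ _ (\sum_(b <- B) norm a)).
  by apply: ler_sum => b _; exact: seminorm_grade.
by rewrite big_const_seq count_predT iter_addr addr0 -[X in X <= _]mulr_natl.
Qed.

Lemma seminorm_le_reduced a : A a -> p a <= norm a.
Proof.
move=> Aa; have As := cp_algS Aa; set z := mul (star a) a.
have Az : A z by exact: cp_algM.
have zz : star z = z by rewrite /z cp_star_mul // cp_starK.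
pose B := [seq phi t | t <- cp_supp z].
have powB k t : sqpow z k t != 0 -> phi t \in box B (2 ^ k).
  elim: k t => [|k IH] t /= nz; first by apply: mem_box => //; apply: map_f; rewrite mem_cp_supp.
  have [s [/IH sB /IH tB]] := mul_neq0 (sqpow_alg k Az) nz.
  by rewrite -[t](mulVKg s) phiM expnS mul2n -addnn; exact: box_mul.
have : p z <= norm z.
  (* By [size_box] at most [(2 ^ k).+1 ^ size B] degrees occur in [sqpow z k]; this is where the
     shape of the bound in [poly_power_bound] comes from. *)
  apply: (seminorm_le_of_powers pS (c := 1) (d := size B)) => // k; rewrite mul1r.
  have Ak := sqpow_alg k Az.
  apply: (@le_trans _ _ ((size (undup (box B (2 ^ k))))%:R * norm (sqpow z k))).
    apply: seminorm_degrees => //; first exact: undup_uniq.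
    by move=> t /powB; rewrite mem_undup.
  rewrite ler_wpM2r ?reduced_norm_ge0 // -natrX ler_nat -size_box.
  exact: size_undup.
rewrite (seminorm_cstar pS Aa) (reduced_norm_cstar Aa).
by rewrite ler_pXn2r ?nnegrE ?reduced_norm_ge0 ?(seminorm_ge0 pS).
Qed.

End OneSeminorm.

(** The reduced norm is itself a C*-seminorm and dominates all others, so the supremum is attained
    and is not a default value of [sup]. *)
Lemma full_normE a : A a -> full_norm P X a = norm a.
Proof.
move=> Aa.
have ubd : ubound [set p a | p in cstar_seminorm P X] (norm a).
  by move=> c [p pS <-]; exact: seminorm_le_reduced.
have normS : [set p a | p in cstar_seminorm P X] (norm a).
  by exists norm; first exact: reduced_norm_seminorm.
apply/eqP; rewrite eq_le; apply/andP; split; first by apply: ge_sup => //; exists (norm a).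
by apply: ub_le_sup => //; exists (norm a).
Qed.

(** * Passage to the completions *)

Lemma eq_cauchy_seq (p q : (G -> T -> C) -> R) : (forall a, A a -> p a = q a) ->
  cauchy_seq A p = cauchy_seq A q.
Proof.
move=> pq; apply/funext => u; apply/propext.
by split=> -[Au cu]; split=> // e e0; have := cu e e0; apply: filterS => -[m n];
  rewrite pq //; exact: cp_algB.
Qed.

Lemma eq_seq_equiv (p q : (G -> T -> C) -> R) u v : (forall a, A a -> p a = q a) ->
  (forall n, A (u n)) -> (forall n, A (v n)) -> seq_equiv p u v = seq_equiv q u v.
Proof.
move=> pq Au Av; rewrite /seq_equiv.
by have -> : (fun n => p (u n - v n)) = (fun n => q (u n - v n))
  by apply/funext => n; rewrite pq //; exact: cp_algB.
Qed.

Lemma eq_completion (p q : (G -> T -> C) -> R) : (forall a, A a -> p a = q a) ->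
  completion A p = completion A q.
Proof.
move=> pq; have cE := eq_cauchy_seq pq; rewrite /completion cE.
apply/funext => c; apply/propext.
have eE u : cauchy_seq A q u -> cauchy_seq A q `&` [set v | seq_equiv p u v] =
    cauchy_seq A q `&` [set v | seq_equiv q u v].
  move=> [Au _]; apply/seteqP.
  by split=> v [/[dup] qv [Av _]] /=; rewrite (eq_seq_equiv pq Au Av).
by split=> -[u qu ->]; exists u => //; rewrite eE.
Qed.

Lemma seq_equiv_refl u : seq_equiv norm u u.
Proof.
rewrite /seq_equiv; under eq_fun do rewrite subrr (seminorm0 reduced_norm_seminorm).
exact: cvg_cst.
Qed.

Lemma seq_equiv_trans u v z : (forall n, A (u n)) -> (forall n, A (v n)) ->
  (forall n, A (z n)) -> seq_equiv norm u v -> seq_equiv norm v z -> seq_equiv norm u z.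
Proof.
move=> Au Av Az uv vz.
apply: (@squeeze_cvgr _ _ _ _ (fun=> 0) (fun n => norm (u n - v n) + norm (v n - z n))).
- apply: nearW => n; rewrite reduced_norm_ge0 /=.
  have -> : u n - z n = (u n - v n) + (v n - z n) by rewrite addrA subrK.
  by apply: (seminormD reduced_norm_seminorm); exact: cp_algB.
- exact: cvg_cst.
- by rewrite -[X in _ --> X]addr0; exact: cvgD uv vz.
Qed.

Lemma completion_map_id (c : set (nat -> G -> T -> C)) : completion A norm c ->
  completion_map A norm norm c = c.
Proof.
move=> [u cu ->]; have [Au _] := cu; apply/seteqP; split=> v.
  move=> [cv [z [[Az _] uz] zv]]; split; first exact: cv.
  by have [Av _] := cv; exact: (seq_equiv_trans Au Az Av uz zv).
move=> [cv uv]; split; first exact: cv.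
by exists v; [split; [exact: cv|exact: uv]|exact: seq_equiv_refl].
Qed.

(** The two norms agree on the algebra, so both completions are the same set of classes and the
    canonical map is its identity. *)
Lemma amenable_of_grading : amenable R P X.
Proof.
rewrite /amenable /full_crossed_product /reduced_crossed_product.
have fE := full_normE.
have -> : completion_map A (full_norm P X) norm = completion_map A norm norm.
  by [].
rewrite (eq_completion fE); split.
- by move=> c cc; rewrite /= completion_map_id.
- by move=> c d /set_mem cc /set_mem dd; rewrite !completion_map_id.
- by move=> c cc; exists c => //; exact: completion_map_id.
Qed.

End Grading.
End Seminorms.
End CrossedProduct.

Theorem corollary4p8 (R : realType) (S : countType) (E : rel S)
    (E_sym : symmetric E) (E_irr : irreflexive E) :
  controlled (raag_pos E) (zsum_pos S) (abelianisation E) /\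
  forall X : set (subsets (raag E)),
    nica_closed (raag_pos E) X -> nica_invariant (raag_pos E) X ->
    amenable R (raag_pos E) X.
Proof.
split; first exact: abelianisation_controlled.
move=> X [F Fcl XE] Xinv.
have [Psub PI _] := raag_quasi_lattice E_sym E_irr.
have [Qsub _ _] := zsum_quasi_lattice S.
have join_uniq (x y z z' : raag E) :
  is_join (raag_pos E) x y z -> is_join (raag_pos E) x y z' -> z = z'.
  exact: is_join_uniq.
(* [X] is closed relative to the spectrum, and the spectrum is closed in {0,1}^G. *)
have Xcl : closed X.
  by rewrite XE; apply: closedI => //; exact: nica_spectrum_closed join_uniq.
have XP : X `<=` nica_spectrum (raag_pos E) by rewrite XE => w [].
apply: (amenable_of_grading R XP Xcl Xinv (phi := abelianisation E) _ Qsub Psub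
  join_uniq).
- exact: zsum_commute.
- exact: abelianisationM.
- exact: abelianisation_pos.
- exact: abelianisation_finite.
- by move=> x y z; exact: abelianisation_join.
Qed.
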